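(* Let $W$ be an $8$-dimensional real vector space. A $4$-form $\Phi\in\Lambda^4W^*$ admits a compatible inner product if and only if it satisfies the following condition: (C) $\Phi$ is nondegenerate and, if $u,v,w\in W$ are linearly independent and $$\iota(v)\iota(u)\Phi\wedge\iota(w)\iota(u)\Phi\wedge\Phi=\iota(u)\iota(v)\Phi\wedge\iota(w)\iota(v)\Phi\wedge\Phi=0,$$ then, for all $x\in W$, we have $$\iota(w)\iota(u)\Phi\wedge\iota(x)\iota(u)\Phi\wedge\Phi=0\iff\iota(w)\iota(v)\Phi\wedge\iota(x)\iota(v)\Phi\wedge\Phi=0.$$ If this holds, then the compatible inner product is uniquely determined by $\Phi$.
   Context: For a form $\alpha$, $\iota(u)\alpha$ is the interior product $\alpha(u,\cdot,\dots,\cdot)$. A $4$-form $\Phi\in\Lambda^4W^*$ on an $8$-dimensional real vector space $W$ is called nondegenerate if for every triple $u,v,w$ of linearly independent vectors in $W$ there is a vector $x\in W$ such that $\Phi(u,v,w,x)\neq0$. An alternating multi-linear map $W^3\to W$, $(u,v,w)\mapsto u\times v\times w$, on a finite dimensional real Hilbert space $W$ is called a triple cross product if $\langle u\times v\times w,u\rangle=\langle u\times v\times w,v\rangle=\langle u\times v\times w,w\rangle=0$ and $|u\times v\times w|=|u\wedge v\wedge w|$ for all $u,v,w\in W$, where $|u\wedge v\wedge w|^2$ denotes the determinant of the Gram matrix of $u,v,w$. An inner product on $W$ is called compatible with $\Phi$ if the map $W^3\to W$ defined by $\langle x,u\times v\times w\rangle:=\Phi(x,u,v,w)$ is a triple cross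 product. *)

(* Defs.v *)
From mathcomp Require Import all_boot all_order all_algebra all_fingroup.
From mathcomp Require Import reals.

Set Implicit Arguments.
Unset Strict Implicit.
Unset Printing Implicit Defensive.

Import Order.TTheory GRing.Theory Num.Theory.
Local Open Scope ring_scope.

Definition update (T : Type) (k : nat) (t : k.-tuple T) (i : 'I_k) (x : T) :
    k.-tuple T :=
  [tuple if j == i then x else tnth t j | j < k].

Definition multilinear (R : realType) (W V : lmodType R) (k : nat)
    (f : k.-tuple W -> V) : Prop :=
  forall (t : k.-tuple W) (i : 'I_k), linear (fun x => f (update t i x)).

Definition alternating (R : realType) (W V : lmodType R) (k : nat)
    (f : k.-tuple W -> V) : Prop :=
  multilinear f /\
  forall (t : k.-tuple W) (i j : 'I_k),
    i != j -> tnth t i = tnth t j -> f t = 0.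

(* The elements of Lambda^k W^*; the regular module R^o makes R a codomain. *)
Definition alternating_form (R : realType) (W : lmodType R) (k : nat)
    (f : k.-tuple W -> R) : Prop :=
  alternating (V := R^o) f.

Definition iota_form (R : realType) (W : lmodType R) (k : nat) (u : W)
    (a : k.+1.-tuple W -> R) : k.-tuple W -> R :=
  fun t => a [tuple of u :: t].

(* The normalisation 1/(p! q!) makes this the sum over (p, q)-shuffles for
   alternating a and b. *)
Definition wedge (R : realType) (W : lmodType R) (p q : nat)
    (a : p.-tuple W -> R) (b : q.-tuple W -> R) : (p + q)%N.-tuple W -> R :=
  fun t => (p`! * q`!)%N%:R^-1 *
    \sum_(s : 'S_(p + q)%N)
      (-1) ^+ s * a [tuple tnth t (s (lshift q i)) | i < p]
                * b [tuple tnth t (s (rshift p j)) | j < q].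

Definition nondegenerate_form (R : realType) (W : vectType R)
    (Phi : 4.-tuple W -> R) : Prop :=
  forall u v w : W, free [:: u; v; w] ->
    exists x : W, Phi [tuple u; v; w; x] != 0.

(* The library type {dot W for idfun} consists of the bilinear, symmetric,
   positive definite forms on W. *)
Definition norm (R : realType) (W : lmodType R) (g : {dot W for idfun})
    (u : W) : R :=
  Num.sqrt (g u u).

Definition norm_wedge (R : realType) (W : lmodType R) (g : {dot W for idfun})
    (k : nat) (t : k.-tuple W) : R :=
  Num.sqrt (\det (\matrix_(i < k, j < k) g (tnth t i) (tnth t j))).

Definition triple_cross_product (R : realType) (W : lmodType R)
    (g : {dot W for idfun}) (m : 3.-tuple W -> W) : Prop :=
  alternating m /\
  forall u v w : W,
    [/\ g (m [tuple u; v; w]) u = 0,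
        g (m [tuple u; v; w]) v = 0,
        g (m [tuple u; v; w]) w = 0
      & norm g (m [tuple u; v; w]) = norm_wedge g [tuple u; v; w]].

(* On a finite dimensional W the map m exists and is unique. *)
Definition compatible (R : realType) (W : vectType R)
    (g : {dot W for idfun}) (Phi : 4.-tuple W -> R) : Prop :=
  exists m : 3.-tuple W -> W,
    (forall x u v w : W, g x (m [tuple u; v; w]) = Phi [tuple x; u; v; w]) /\
    triple_cross_product g m.

Definition condition_C (R : realType) (W : vectType R)
    (Phi : 4.-tuple W -> R) : Prop :=
  nondegenerate_form Phi /\
  forall u v w : W, free [:: u; v; w] ->
    wedge (wedge (iota_form v (iota_form u Phi))
                 (iota_form w (iota_form u Phi))) Phi =1 (fun=> 0) ->
    wedge (wedge (iota_form u (iota_form v Phi))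
                 (iota_form w (iota_form v Phi))) Phi =1 (fun=> 0) ->
    forall x : W,
      wedge (wedge (iota_form w (iota_form u Phi))
                   (iota_form x (iota_form u Phi))) Phi =1 (fun=> 0) <->
      wedge (wedge (iota_form w (iota_form v Phi))
                   (iota_form x (iota_form v Phi))) Phi =1 (fun=> 0).

(* Main.v *)
From HB Require Import structures.
Require Import Defs.
From mathcomp Require Import all_boot all_order all_algebra all_fingroup.
From mathcomp Require Import reals.
From mathcomp Require Import boolp classical_sets topology normedtype derive.
From mathcomp Require Import ring lra.
Local Open Scope ring_scope.

(** For vectors u, v put omega_uv = Phi(u, v, ., .), and let theta u v w x be the
    8-form omega_uv ^ omega_wx ^ Phi. Evaluated on a basis, theta is a symmetric
    bilinear form on bivectors, and K(u, v) = theta u v u v plays the role of a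
    sectional curvature. Condition (C) only involves polarisations of K, and the
    theorem is a comparison of K with the curvature of a round metric,
    |u ^ v|^2 = |u|^2 |v|^2 - <u, v>^2. The link between K and Phi is a Pfaffian:
    on a basis that starts with u and v, K(u, v) is 6 times the Pfaffian of
    omega_uv on the other six vectors (theta_pf).

    Suppose that a compatible inner product exists. For orthonormal u and v, the
    form omega_uv is given by a skew isometry of the orthogonal complement, so its
    Pfaffian is 1 or -1; by definiteness the sign is constant, and
    K = 6 |u ^ v|^2 or K = - 6 |u ^ v|^2 (cross_curvature). For such a K the
    hypotheses of (C) say that w is orthogonal to u and v, and the conclusion is
    clear (curvature_condC). Since |u ^ v|^2 up to a factor determines the metric
    up to a factor (gram2_proportional), and the length of a triple product fixes
    that factor, the inner product is unique (cross_unique).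

    Conversely, nondegeneracy makes omega_uv symplectic on a complement of u, v
    for independent u and v. So K(u, v) is nonzero (nondegenerate_theta), and
    then its sign is constant (biform_definite). Condition (C) says that
    the quadratic forms K(u, .) and K(v, .) are conformal on the vectors that are
    orthogonal, in the sense of K, to u and v; moving the pair u, v around shows
    that K is a multiple of |u ^ v|^2 for some inner product (inner_of_curvature).

    It remains to see that such a metric is compatible with Phi after rescaling.
    Write K = 6 kappa |u ^ v|^2, and let a be the maximum of Phi on unit vectors,
    attained at h1, h2, h3, h4 (max_unit). The first-order conditions make these
    vectors orthonormal and split Phi. On the orthogonal complement U of their
    span, the three 2-forms Phi(h1, h_i, ., .), for i = 2, 3, 4, are orthogonal for
    the wedge product and, in a suitable orientation, have Pfaffian kappa / a, by
    the values of K on h1 and combinations of the h_i. The values of K on h1 and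
    vectors of U say that the quadratic form on U built from this triple is, up to
    sign, kappa times the metric. A computation with quaternion relations then gives a^6 = kappa^2
    (quaternion_scale, frame_scale). On the other hand, for orthonormal u, v, w
    the Pfaffian of omega_uv is a product of three values of Phi on orthonormal
    vectors, the first one being the length of the covector Phi(u, v, w, .) up to
    sign. Each factor is at most a in absolute value, and their product is a^3 in
    absolute value, so the length is a for every orthonormal triple
    (comass_attained). Dividing out this constant by a rescaling of the metric
    yields a triple cross product (calibrated_compatible). *)
Set Implicit Arguments.
Unset Strict Implicit.
Unset Printing Implicit Defensive.
Import Order.TTheory GRing.Theory Num.Theory.
Import numFieldTopology.Exports numFieldNormedType.Exports.

(** * Multilinear expansion and antisymmetrisation *)

Section MultilinearExpansion.
Variables (R : realType) (W : lmodType R).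

Notation form n := (n.-tuple W -> R) (only parsing).

Lemma multilinear_cons n (F : form n.+1) x :
  multilinear (V := R^o) F ->
  multilinear (V := R^o) (fun t : n.-tuple W => F [tuple of x :: t]).
Proof.
move=> mF t i a y z.
have E u : [tuple of x :: update t i u] = update [tuple of x :: t] (lift ord0 i) u.
  apply: eq_from_tnth => j; rewrite tnth_mktuple.
  by case: (unliftP ord0 j) => [k ->|->]; rewrite ?tnthS ?tnth0 ?tnth_mktuple ?(inj_eq lift_inj).
by rewrite !E mF.
Qed.

Lemma multilinear_head n (F : form n.+1) (t : n.-tuple W) :
  multilinear (V := R^o) F -> linear ((fun x => F [tuple of x :: t]) : W -> R^o).
Proof.
move=> mF a x y.
have E u : [tuple of u :: t] = update [tuple of 0 :: t] ord0 u.
  apply: eq_from_tnth => j; rewrite tnth_mktuple.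
  by case: (unliftP ord0 j) => [k ->|->]; rewrite ?tnthS ?tnth0 ?eqxx.
by rewrite (E (_ + _)) (E x) (E y) mF.
Qed.

(** Induction on the number of slots: linearity expands the head slot, and the
    remaining slots form a multilinear function of one argument fewer. *)
Lemma multilinear_sum m (f : 'I_m -> W) n (F : form n) (c : 'I_n -> 'I_m -> R) :
  multilinear (V := R^o) F ->
  F [tuple \sum_j c i j *: f j | i < n] =
  \sum_(p : n.-tuple 'I_m)
     (\prod_(i < n) c i (tnth p i)) * F [tuple f (tnth p i) | i < n].
Proof.
elim: n F c => [|n IH] F c mF.
  rewrite (big_pred1 [tuple]) => [|p]; last by rewrite [p]tuple0 [RHS]eqxx.
  by rewrite big_ord0 mul1r; congr F; apply: eq_from_tnth => -[].
pose L x := \sum_(p : n.-tuple 'I_m) (\prod_(i < n) c (lift ord0 i) (tnth p i))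
   * F [tuple of x :: [tuple f (tnth p i) | i < n]].
have FL x : F [tuple of x :: [tuple \sum_j c (lift ord0 i) j *: f j | i < n]] = L x.
  exact: (IH (fun t => F [tuple of x :: t]) (fun i => c (lift ord0 i)) (multilinear_cons x mF)).
have -> : [tuple \sum_j c i j *: f j | i < n.+1] =
  [tuple of \sum_j c ord0 j *: f j :: [tuple \sum_j c (lift ord0 i) j *: f j | i < n]].
  apply: eq_from_tnth => j; rewrite tnth_mktuple.
  by case: (unliftP ord0 j) => [k ->|->]; rewrite ?tnthS ?tnth0 ?tnth_mktuple.
have lin := multilinear_head [tuple \sum_j c (lift ord0 i) j *: f j | i < n] mF.
pose l : {linear W -> R^o} := HB.pack (fun x => F _) (GRing.isLinear.Build _ _ _ _ _ lin).
have -> : F [tuple of \sum_j c ord0 j *: f j :: [tuple \sum_j c (lift ord0 i) j *: f j | i < n]]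
   = \sum_j c ord0 j * L (f j).
  rewrite -[LHS]/(l (\sum_j c ord0 j *: f j)) linear_sum; apply: eq_bigr => j _.
  by rewrite linearZ -FL.
rewrite (reindex (fun q : 'I_m * n.-tuple 'I_m => [tuple of q.1 :: q.2])) /=; last first.
  exists (fun p : n.+1.-tuple 'I_m => (thead p, [tuple of behead p])) => [[j p]|p] _ /=.
    by congr pair; apply: val_inj.
  by rewrite -tuple_eta.
rewrite -(pair_bigA _ (fun j (p : n.-tuple 'I_m) =>
  (\prod_(i < n.+1) c i (tnth [tuple of j :: p] i)) *
  F [tuple f (tnth [tuple of j :: p] i) | i < n.+1])) /=.
apply: eq_bigr => j _; rewrite /L big_distrr /=; apply: eq_bigr => p _.
rewrite big_ord_recl tnth0 mulrA; congr (_ * _ * F _).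
  by apply: eq_bigr => i _; rewrite tnthS.
apply: eq_from_tnth => i; rewrite tnth_mktuple.
by case: (unliftP ord0 i) => [k ->|->]; rewrite ?tnthS ?tnth0 ?tnth_mktuple.
Qed.

Definition asym n (F : form n) : form n :=
  fun t => \sum_(s : 'S_n) (-1) ^+ s * F [tuple tnth t (s i) | i < n].

(** When two arguments agree, composing with their transposition matches the
    even permutations with the odd ones, term by term and with opposite signs. *)
Lemma asym_alternating n (F : form n) :
  multilinear (V := R^o) F -> alternating_form (asym F).
Proof.
move=> mF; split=> [t k a x y|t i j nij tij].
  rewrite /asym scaler_sumr -big_split /=; apply: eq_bigr => s _.
  have E u : [tuple tnth (update t k u) (s i) | i < n] =
             update [tuple tnth t (s i) | i < n] (s^-1%g k) u.
    apply: eq_from_tnth => i; rewrite !tnth_mktuple.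
    by rewrite -(inj_eq (@perm_inj _ s) i) permKV.
  by rewrite !E mF /= mulrDr; congr (_ + _); rewrite [in RHS]/GRing.scale /= mulrCA.
rewrite /asym (bigID (fun s : 'S_n => odd_perm s)) /= addrC.
rewrite [X in _ + X](reindex_inj (mulIg (tperm i j))) /=.
rewrite [X in _ + X](eq_bigl (fun s : 'S_n => ~~ odd_perm s)); last first.
  by move=> s; rewrite odd_permM odd_tperm nij addbT.
rewrite -big_split big1 //= => s _.
rewrite odd_permM odd_tperm nij addbT signrN mulNr; apply/eqP; rewrite subr_eq0.
apply/eqP; congr (_ * F _); apply: eq_from_tnth => k; rewrite !tnth_mktuple permM.
by case: tpermP => // ->.
Qed.

(** Expanding every slot over f gives a sum over index tuples. The coefficient
    of a tuple is the determinant of the columns of M that it selects: zero if an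
    index is repeated, and a signed determinant of M if the tuple is a
    permutation. *)
Lemma asym_det n (F : form n) (M : 'M[R]_n) (f : 'I_n -> W) :
  multilinear (V := R^o) F ->
  asym F [tuple \sum_j M i j *: f j | i < n] = \det M * asym F [tuple f i | i < n].
Proof.
move=> mF; rewrite /asym.
pose D (p : n.-tuple 'I_n) := \det (\matrix_(i, j) M j (tnth p i)).
transitivity (\sum_(p : n.-tuple 'I_n) D p * F [tuple f (tnth p i) | i < n]).
  rewrite [RHS](eq_bigr (fun p : n.-tuple 'I_n => \sum_(s : 'S_n) (-1) ^+ s *
     ((\prod_(i < n) M (s i) (tnth p i)) * F [tuple f (tnth p i) | i < n]))).
    rewrite exchange_big /=; apply: eq_bigr => s _.
    rewrite -big_distrr /= -(multilinear_sum f (fun i => M (s i)) mF).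
    by congr (_ * F _); apply: eq_from_tnth => i; rewrite !tnth_mktuple.
  move=> p _; rewrite /D /determinant big_distrl /=; apply: eq_bigr => s _.
  by rewrite mulrA; do 2 congr (_ * _); apply: eq_bigr => i _; rewrite mxE.
pose P (p : n.-tuple 'I_n) := injectiveb (tnth p).
rewrite (bigID P) /= [X in _ + X]big1 ?addr0 => [|p Np]; last first.
  rewrite (_ : D p = 0) ?mul0r //.
  have /injectivePn[i [j nij pij]] := Np.
  by apply: (determinant_alternate nij) => k; rewrite !mxE pij.
rewrite (reindex (fun s : 'S_n => [tuple s i | i < n])) /=; last first.
  exists (fun p : n.-tuple 'I_n => insubd (1%g : 'S_n) [ffun i => tnth p i]) => [s _|p Pp].
    apply: val_inj; rewrite val_insubd; apply/ffunP => i /=.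
    case: ifP => [_|/negP[]]; first by rewrite ffunE tnth_mktuple -pvalE.
    by apply/injectiveP => x y; rewrite !ffunE !tnth_mktuple => /perm_inj.
  apply: eq_from_tnth => i; rewrite tnth_mktuple.
  rewrite -pvalE val_insubd ifT ?ffunE //.
  apply/injectiveP => x y; rewrite !ffunE; move: x y; apply/injectiveP; exact: Pp.
rewrite big_distrr /= (eq_bigl xpredT) => [|s]; last first.
  by apply/injectiveP => x y; rewrite !tnth_mktuple => /perm_inj.
apply: eq_bigr => s _; rewrite mulrA; congr (_ * F _); last first.
  by apply: eq_from_tnth => i; rewrite !tnth_mktuple.
rewrite /D -[M in RHS]trmxK det_tr mulrC -det_perm -det_mulmx -row_permE.
by congr (\det _); apply/matrixP => i j; rewrite !mxE tnth_mktuple.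
Qed.

End MultilinearExpansion.

(** * Antisymmetrisation slot by slot *)

Section Alt.
Variables (R : realType) (W : lmodType R).

(** The permutations are sorted by the vector that they put into the first
    slot, as in the Laplace expansion of a determinant. *)
Lemma asym_recl n (F : n.+1.-tuple W -> R) (t : n.+1.-tuple W) :
  asym F t = \sum_(j < n.+1) (-1) ^+ j *
    asym (fun u : n.-tuple W => F [tuple of tnth t j :: u])
         [tuple tnth t (lift j i) | i < n].
Proof.
rewrite /asym (partition_big (fun s : 'S_n.+1 => s ord0) xpredT) //=.
apply: eq_bigr => j _; rewrite (reindex (lift_perm ord0 j)); last first.
  pose ulsf i (s : 'S_n.+1) k := odflt k (unlift (s i) (s (lift i k))).
  have ulsfK i (s : 'S_n.+1) k: lift (s i) (ulsf i s k) = s (lift i k).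
    rewrite /ulsf; have:= neq_lift i k.
    by rewrite -(can_eq (permK s)) => /unlift_some[] ? ? ->.
  have inj_ulsf: injective (ulsf ord0 _).
    move=> s; apply: can_inj (ulsf (s ord0) s^-1%g) _ => k'.
    by rewrite {1}/ulsf ulsfK !permK liftK.
  exists (fun s => perm (inj_ulsf s)) => [s _ | s].
    by apply/permP=> k'; rewrite permE /ulsf lift_perm_lift lift_perm_id liftK.
  move/(s _ =P _) => si0; apply/permP=> k.
  case: (unliftP ord0 k) => [k'|] ->; rewrite ?lift_perm_id //.
  by rewrite lift_perm_lift -si0 permE ulsfK.
rewrite big_distrr /=; apply: eq_big => [s|s _].
  by rewrite lift_perm_id eqxx.
rewrite odd_lift_perm signr_addb signr_odd mulrA; congr (_ * F _).
apply: eq_from_tnth => k; rewrite tnth_mktuple.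
by case: (unliftP ord0 k) => [k' ->|->];
  rewrite ?tnthS ?tnth0 ?tnth_mktuple ?lift_perm_id ?lift_perm_lift.
Qed.

(** The antisymmetrisation unfolded one slot at a time over a list of vectors,
    in a form that computes on explicit lists. *)
Fixpoint asym_rec n (F : seq W -> R) (s : seq W) : R :=
  if n is m.+1 then
    \sum_(j <- iota 0 n) (-1) ^+ j *
      asym_rec m (fun u => F (nth 0 s j :: u)) (take j s ++ drop j.+1 s)
  else F [::].

Lemma asym_recS n F s : asym_rec n.+1 F s = \sum_(j <- iota 0 n.+1) (-1) ^+ j *
  asym_rec n (fun u => F (nth 0 s j :: u)) (take j s ++ drop j.+1 s).
Proof. by []. Qed.
Arguments asym_rec : simpl never.

Lemma asym_asym_rec n (F : n.-tuple W -> R) (F' : seq W -> R) (t : n.-tuple W) :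
  (forall u : n.-tuple W, F u = F' u) -> asym F t = asym_rec n F' t.
Proof.
elim: n F F' t => [|n IH] F F' t FF'.
  rewrite /asym (big_pred1 1%g) => [|s]; last first.
    by rewrite [RHS]/=; apply/esym/eqP/permP => -[].
  by rewrite odd_perm1 mul1r FF' [mktuple _]tuple0.
rewrite asym_recl asym_recS -[iota _ _]/(index_iota 0 n.+1) big_mkord.
apply: eq_bigr => j _; congr (_ * _).
rewrite (IH _ (fun u => F' (nth 0 t j :: u))) => [|u]; last first.
  by rewrite FF' /= (tnth_nth 0).
congr (asym_rec n _ _).
apply: (@eq_from_nth _ 0) => [|i].
  by rewrite size_tuple size_cat size_take size_drop size_tuple ltn_ord subSS subnKC // -ltnS.
rewrite size_tuple => lin; rewrite -[i]/(val (Ordinal lin)) -tnth_nth tnth_mktuple.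
rewrite (tnth_nth 0) /= nth_cat size_take size_tuple ltn_ord /bump.
case: ltnP => ij; first by rewrite nth_take.
by rewrite nth_drop addSn subnKC.
Qed.

Lemma asym_rec0 n (F : seq W -> R) s : (forall u, F u = 0) -> asym_rec n F s = 0.
Proof.
elim: n F s => [|n IH] F s F0; first exact: F0.
rewrite asym_recS.
by rewrite big1 // => j _; rewrite IH ?mulr0.
Qed.

(** Vectors that annihilate the head slot can be left out there. This cuts the
    expansion of an eight-slot product down to the few hundred terms that matter.
    *)
Lemma asym_rec_kill2 n (F : seq W -> R) u v s :
  (forall l, F (u :: l) = 0) -> (forall l, F (v :: l) = 0) ->
  asym_rec n.+3 F (u :: v :: s) = \sum_(j <- iota 0 n.+1) (-1) ^+ j *
    asym_rec n.+2 (fun l => F (nth 0 s j :: l)) (u :: v :: take j s ++ drop j.+1 s).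
Proof.
move=> Fu Fv; rewrite asym_recS -[iota _ _]/([:: 0, 1 & iota (2 + 0) n.+1]%N) iotaDl.
rewrite [LHS]big_cons [X in _ + X = _]big_cons big_map [nth 0 _ 0]/= [nth 0 _ 1]/= (asym_rec0 _ _ Fu) (asym_rec0 _ _ Fv).
rewrite !mulr0 !add0r; apply: eq_bigr => j _.
by rewrite add2n !exprS !mulN1r opprK.
Qed.

End Alt.
Arguments asym_rec : simpl never.

(** * Pfaffians *)

Section Pf.
Variables (R : realType) (W : lmodType R).

(** The Pfaffian of the skew matrix of the values of a on four vectors; on six
    vectors, pf6 is its expansion along the first row. *)
Definition pf4 (a : W -> W -> R) x y z w :=
  a x y * a z w - a x z * a y w + a x w * a y z.

Definition pf6 (a : W -> W -> R) p q r s t u :=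
  a p q * pf4 a r s t u - a p r * pf4 a q s t u + a p s * pf4 a q r t u
  - a p t * pf4 a q r s u + a p u * pf4 a q r s t.

Lemma asym_rec_scale n k (F : seq W -> R) s :
  asym_rec n (fun l => k * F l) s = k * asym_rec n F s.
Proof.
elim: n F s => [|n IH] F s; first by [].
by rewrite !asym_recS big_distrr; apply: eq_bigr => j _; rewrite IH mulrCA.
Qed.

(** The value is given by a match on the list, so that the lemma can rewrite
    under the binder of a sum where the list is not yet explicit. *)
Lemma asym_rec4_alternating (C : W -> W -> W -> W -> R) k s :
  (forall x y z w, C y x z w = - C x y z w) ->
  (forall x y z w, C x z y w = - C x y z w) ->
  (forall x y z w, C x y w z = - C x y z w) ->
  asym_rec 4 (fun l => k * C l`_0 l`_1 l`_2 l`_3) s =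
  k * (if s is [:: p; q; r; t] then 24 * C p q r t
       else asym_rec 4 (fun l => C l`_0 l`_1 l`_2 l`_3) s).
Proof.
move=> C01 C12 C23; rewrite asym_rec_scale; congr (_ * _).
case: s => [//|p [//|q [//|r [//|t []//]]]].
do 4 rewrite !asym_recS /= unlock /=.
rewrite /asym_rec /= !(C23 _ _ p) !(C12 _ p) !(C01 p) !(C23 _ _ q) !(C12 _ q) !(C23 _ _ r).
ring.
Qed.

(** Here 2 * pf4 a is the square of the 2-form a, so this evaluates a ^ a ^ C
    on a basis that starts with two vectors u and v in the kernel of a. Both of
    them must fill slots of C, where they turn C into a, and what remains is a ^ a
    ^ a, which is 6 times the Pfaffian. The factors 24 are the permutations within
    each block of four slots. *)
Lemma asym_rec8_pf (a : W -> W -> R) (C : W -> W -> W -> W -> R) u v x1 x2 x3 x4 x5 x6 :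
  (forall x y z w, C y x z w = - C x y z w) ->
  (forall x y z w, C x z y w = - C x y z w) ->
  (forall x y z w, C x y w z = - C x y z w) ->
  (forall x y, a y x = - a x y) ->
  (forall x, a u x = 0) -> (forall x, a v x = 0) ->
  (forall x y, C u v x y = a x y) ->
  asym_rec 8 (fun l => 2 * pf4 a l`_0 l`_1 l`_2 l`_3 * C l`_4 l`_5 l`_6 l`_7)
    [:: u; v; x1; x2; x3; x4; x5; x6] = 24 * 24 * 6 * pf6 a x1 x2 x3 x4 x5 x6.
Proof.
move=> C01 C12 C23 aC au av Cuv.
have au' x : a x u = 0 by rewrite aC au oppr0.
have av' x : a x v = 0 by rewrite aC av oppr0.
rewrite asym_rec_kill2; last 2 first.
- by move=> l /=; rewrite /pf4 !au; ring.
- by move=> l /=; rewrite /pf4 !av; ring.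
under eq_bigr => i _.
  rewrite asym_rec_kill2; last 2 first.
  - by move=> l /=; rewrite /pf4 !au !au'; ring.
  - by move=> l /=; rewrite /pf4 !av !av'; ring.
  under eq_bigr => j _.
    rewrite asym_rec_kill2; last 2 first.
    - by move=> l /=; rewrite /pf4 !au !au'; ring.
    - by move=> l /=; rewrite /pf4 !av !av'; ring.
    under eq_bigr => k _.
      rewrite asym_rec_kill2; last 2 first.
      - by move=> l /=; rewrite /pf4 !au' ; ring.
      - by move=> l /=; rewrite /pf4 !av' ; ring.
      under eq_bigr => l _ do rewrite /= asym_rec4_alternating //.
      over.
    over.
  over.
rewrite unlock /=.
rewrite !Cuv.
rewrite /pf6 /pf4.
(* Only the pairs x_i, x_j with i < j are kept as variables of the polynomial
   identity. *)
have aa x : a x x = 0 by have := aC x x; lra.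
rewrite !(aC x1) !(aC x2 x3) !(aC x2 x4) !(aC x2 x5) !(aC x2 x6) !(aC x3 x4) !(aC x3 x5) !(aC x3 x6) !(aC x4 x5) !(aC x4 x6) !(aC x5 x6).
ring.
Qed.

End Pf.

(** * Wedge products *)

Section Wedge.
Variables (R : realType) (W : lmodType R).

Definition tensor p q (a : p.-tuple W -> R) (b : q.-tuple W -> R) :
    (p + q)%N.-tuple W -> R :=
  fun t => a [tuple tnth t (lshift q i) | i < p] * b [tuple tnth t (rshift p j) | j < q].

Lemma wedge_asym p q (a : p.-tuple W -> R) (b : q.-tuple W -> R) t :
  wedge a b t = (p`! * q`!)%N%:R^-1 * asym (tensor a b) t.
Proof.
congr (_ * _); apply: eq_bigr => s _; rewrite /tensor mulrA.
by congr (_ * a _ * b _); apply: eq_from_tnth => i; rewrite !tnth_mktuple.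
Qed.

Lemma tensor_multilinear p q (a : p.-tuple W -> R) (b : q.-tuple W -> R) :
  multilinear (V := R^o) a -> multilinear (V := R^o) b ->
  multilinear (V := R^o) (tensor a b).
Proof.
move=> ma mb t k c x y; rewrite /tensor.
case: (split_ordP k) => i ->.
- have E u : [tuple tnth (update t (lshift q i) u) (lshift q i0)  | i0 < p] =
     update [tuple tnth t (lshift q i0)  | i0 < p] i u.
    by apply: eq_from_tnth => j; rewrite !tnth_mktuple (inj_eq (@lshift_inj _ _)).
  have E' u : [tuple tnth (update t (lshift q i) u) (rshift p j)  | j < q] =
     [tuple tnth t (rshift p j)  | j < q].
    by apply: eq_from_tnth => j; rewrite !tnth_mktuple eq_rlshift.
  by rewrite !E !E' ma /= mulrDl [in RHS]/GRing.scale /= mulrA.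
- have E u : [tuple tnth (update t (rshift p i) u) (rshift p i0)  | i0 < q] =
     update [tuple tnth t (rshift p i0)  | i0 < q] i u.
    by apply: eq_from_tnth => j; rewrite !tnth_mktuple (inj_eq (@rshift_inj _ _)).
  have E' u : [tuple tnth (update t (rshift p i) u) (lshift q j)  | j < p] =
     [tuple tnth t (lshift q j)  | j < p].
    by apply: eq_from_tnth => j; rewrite !tnth_mktuple eq_lrshift.
  by rewrite !E !E' mb /= mulrDr [in RHS]/GRing.scale /= mulrCA.
Qed.

Lemma wedge_alternating p q (a : p.-tuple W -> R) (b : q.-tuple W -> R) :
  multilinear (V := R^o) a -> multilinear (V := R^o) b ->
  alternating_form (wedge a b).
Proof.
move=> ma mb; have [mw aw] := asym_alternating (tensor_multilinear ma mb).
split=> [t k c x y|t i j nij tij]; last by rewrite wedge_asym (aw t i j) ?mulr0.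
by rewrite !wedge_asym mw mulrDr [in RHS]/GRing.scale /= mulrCA.
Qed.

Lemma wedge_det p q (a : p.-tuple W -> R) (b : q.-tuple W -> R)
    (M : 'M[R]_(p + q)) (f : 'I_(p + q) -> W) :
  multilinear (V := R^o) a -> multilinear (V := R^o) b ->
  wedge a b [tuple \sum_j M i j *: f j | i < (p + q)%N] =
  \det M * wedge a b [tuple f i | i < (p + q)%N].
Proof.
move=> ma mb; rewrite 2!wedge_asym (asym_det M f (tensor_multilinear ma mb)).
exact: mulrCA.
Qed.

Lemma wedge_linl p q (a a1 a2 : p.-tuple W -> R) (b : q.-tuple W -> R) c t :
  (forall u, a u = c * a1 u + a2 u) ->
  wedge a b t = c * wedge a1 b t + wedge a2 b t.
Proof.
move=> E; rewrite !wedge_asym mulrCA -mulrDr; congr (_ * _).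
rewrite /asym big_distrr -big_split; apply: eq_bigr => s _ /=.
by rewrite /tensor E; move: ((-1) ^+ s) => e; ring.
Qed.

Lemma eq_wedgel p q (a a1 : p.-tuple W -> R) (b : q.-tuple W -> R) t :
  a =1 a1 -> wedge a b t = wedge a1 b t.
Proof.
move=> E; rewrite !wedge_asym; congr (_ * _); apply: eq_bigr => s _.
by rewrite /tensor E.
Qed.

Lemma tuple2E n (t : n.-tuple W) (k : 'I_2 -> 'I_n) :
  [tuple tnth t (k i) | i < 2] =
  [tuple nth 0 t (k ord0); nth 0 t (k ord_max)].
Proof.
apply: eq_from_tnth => i; rewrite tnth_mktuple !(tnth_nth 0) /=.
by case: i => -[|[|//]] lt /=; congr (nth 0 t (k _)); apply: val_inj.
Qed.

Lemma wedge22 (a b : W -> W -> R) (al be : 2.-tuple W -> R) (t : 4.-tuple W) :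
  (forall x y, al [tuple x; y] = a x y) -> (forall x y, be [tuple x; y] = b x y) ->
  (forall x y, a y x = - a x y) -> (forall x y, b y x = - b x y) ->
  wedge al be t = a t`_0 t`_1 * b t`_2 t`_3 - a t`_0 t`_2 * b t`_1 t`_3
   + a t`_0 t`_3 * b t`_1 t`_2 + a t`_1 t`_2 * b t`_0 t`_3
   - a t`_1 t`_3 * b t`_0 t`_2 + a t`_2 t`_3 * b t`_0 t`_1.
Proof.
move=> alE beE aC bC; rewrite wedge_asym.
rewrite (@asym_asym_rec _ _ (2 + 2) _ (fun l => a l`_0 l`_1 * b l`_2 l`_3)); last first.
  by move=> u; rewrite /tensor !tuple2E alE beE.
case: t => -[//|x [//|y [//|z [//|w []//]]]] st /=.
do 4 rewrite !asym_recS /= unlock /=.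
rewrite /asym_rec /= !(aC x) !(aC y z) !(aC y w) !(aC z w).
rewrite !(bC x) !(bC y z) !(bC y w) !(bC z w).
by rewrite (_ : (2`! * 2`!)%N = 4%N) //; field.
Qed.

Lemma wedge44 (A B : W -> W -> W -> W -> R) (al be : 4.-tuple W -> R) (t : 8.-tuple W) :
  (forall x y z w, al [tuple x; y; z; w] = A x y z w) ->
  (forall x y z w, be [tuple x; y; z; w] = B x y z w) ->
  wedge al be t = (24 * 24)^-1 *
     asym_rec 8 (fun l => A l`_0 l`_1 l`_2 l`_3 * B l`_4 l`_5 l`_6 l`_7) t.
Proof.
move=> alE beE; rewrite wedge_asym -natrM; congr (_ * _).
apply: (@asym_asym_rec _ _ 8) => u; rewrite /tensor.
by rewrite -alE -beE; congr (al _ * be _); apply: eq_from_tnth => i;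
  rewrite tnth_mktuple !(tnth_nth 0) /=; case: i => -[|[|[|[|//]]]] lt.
Qed.

End Wedge.

(** * Alternating forms *)

Section AltFacts.
Variables (R : realType) (W : lmodType R).

Lemma alternating_shear n (f : n.-tuple W -> R) (t t' : n.-tuple W) (i j : 'I_n) :
  alternating_form f -> i != j -> tnth t' i = tnth t i + tnth t j ->
  (forall k, k != i -> tnth t' k = tnth t k) -> f t' = f t.
Proof.
move=> [mf af] nij ti tk.
have -> : t' = update t i (1 *: tnth t j + tnth t i).
  apply: eq_from_tnth => k; rewrite tnth_mktuple.
  by case: eqP => [->|/eqP/tk //]; rewrite ti scale1r addrC.
rewrite mf /= (af _ i j nij) ?scaler0 ?add0r.
  by congr f; apply: eq_from_tnth => k; rewrite tnth_mktuple; case: eqP => [->|].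
by rewrite !tnth_mktuple eqxx eq_sym (negbTE nij).
Qed.

Lemma alternating_swap n (f : n.-tuple W -> R) (t t' : n.-tuple W) (i j : 'I_n) :
  alternating_form f -> i != j -> tnth t' i = tnth t j -> tnth t' j = tnth t i ->
  (forall k, k != i -> k != j -> tnth t' k = tnth t k) -> f t' = - f t.
Proof.
move=> Af nij ti tj tk; have [mf af] := Af.
pose T x y := update (update t i x) j y.
have TE x y k : tnth (T x y) k = if k == j then y else if k == i then x else tnth t k.
  by rewrite !tnth_mktuple.
have lin2 x y y' : f (T x (y + y')) = f (T x y) + f (T x y').
  by have := mf (update t i x) j 1 y y'; rewrite !scale1r.
have lin1 x x' y : f (T (x + x') y) = f (T x y) + f (T x' y).
  have E z : T z y = update (T 0 y) i z.
    apply: eq_from_tnth => k; rewrite TE !tnth_mktuple.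
    by case: (eqVneq k i) => [->|//]; rewrite (negbTE nij).
  by rewrite (E (_ + _)) (E x) (E x'); have := mf (T 0 y) i 1 x x'; rewrite !scale1r.
have diag x : f (T x x) = 0.
  by apply: (af _ i j nij); rewrite !TE !eqxx (negbTE nij).
have /eqP := diag (tnth t i + tnth t j).
rewrite lin1 !lin2 !diag addr0 add0r addrC addr_eq0 => /eqP E.
have -> : t' = T (tnth t j) (tnth t i).
  apply: eq_from_tnth => k; rewrite TE; case: eqP => [->//|/eqP kj].
  by case: eqP => [->//|/eqP ki]; rewrite tk.
rewrite E; congr (- f _); apply: eq_from_tnth => k; rewrite TE.
by case: eqP => [->//|_]; case: eqP => [->|].
Qed.

(** Linearity in the first slot and the three adjacent transpositions imply
    every other symmetry of an alternating four-form. *)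
Record alt4form (F : W -> W -> W -> W -> R) : Prop := Alt4form {
  a4lin : forall c x y u v w, F (c *: x + y) u v w = c * F x u v w + F y u v w;
  a4C01 : forall x y z w, F y x z w = - F x y z w;
  a4C12 : forall x y z w, F x z y w = - F x y z w;
  a4C23 : forall x y z w, F x y w z = - F x y z w }.

Lemma alt4form_of (Phi : 4.-tuple W -> R) : alternating_form Phi ->
  alt4form (fun x y z w => Phi [tuple x; y; z; w]).
Proof.
move=> Af; have [mf af] := Af; split=> [c x y u v w|x y z w|x y z w|x y z w].
- have E z : [tuple z; u; v; w] = update [tuple 0; u; v; w] ord0 z.
    by apply: eq_from_tnth => k; rewrite tnth_mktuple !(tnth_nth 0); case: k => -[|[|[|[|//]]]].
  by rewrite (E (_ + _)) (E x) (E y) mf.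
- apply: (@alternating_swap _ _ _ _ (@Ordinal 4 0 isT) (@Ordinal 4 1 isT) Af) => //.
  by move=> k; rewrite !(tnth_nth 0); case: k => -[|[|[|[|//]]]].
- apply: (@alternating_swap _ _ _ _ (@Ordinal 4 1 isT) (@Ordinal 4 2 isT) Af) => //.
  by move=> k; rewrite !(tnth_nth 0); case: k => -[|[|[|[|//]]]].
- apply: (@alternating_swap _ _ _ _ (@Ordinal 4 2 isT) (@Ordinal 4 3 isT) Af) => //.
  by move=> k; rewrite !(tnth_nth 0); case: k => -[|[|[|[|//]]]].
Qed.

End AltFacts.

(** * The curvature of a 4-form *)

Section Theta.
Variables (R : realType) (W : lmodType R) (Phi : 4.-tuple W -> R).
Hypothesis Phi_form : alternating_form Phi.

Let F x y z w := Phi [tuple x; y; z; w].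
Let AF : alt4form F := alt4form_of Phi_form.

(** This is omega_uv ^ omega_wx ^ Phi, where omega_uv = Phi(u, v, ., .). On an
    8-dimensional space it is a multiple of the volume form, and u, v |-> theta u
    v u v behaves like the numerator of a sectional curvature. *)
Definition theta u v w x : 8.-tuple W -> R :=
  wedge (wedge (iota_form v (iota_form u Phi)) (iota_form x (iota_form w Phi))) Phi.

Let omE u v x y : iota_form v (iota_form u Phi) [tuple x; y] = F u v x y.
Proof. by rewrite /iota_form /F; congr Phi; apply: val_inj. Qed.

Let iota_multilinear u v : multilinear (V := R^o) (iota_form v (iota_form u Phi)).
Proof. exact: multilinear_cons (multilinear_cons _ (proj1 Phi_form)). Qed.

Let om_ml u v w x :
  multilinear (V := R^o) (wedge (iota_form v (iota_form u Phi)) (iota_form x (iota_form w Phi))).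
Proof. by have [] := wedge_alternating (iota_multilinear u v) (iota_multilinear w x). Qed.

Lemma theta_alternating u v w x : alternating_form (theta u v w x).
Proof. exact: (wedge_alternating (om_ml u v w x) (proj1 Phi_form)). Qed.

Lemma theta_det u v w x (M : 'M[R]_8) (f : 'I_8 -> W) :
  theta u v w x [tuple \sum_j M i j *: f j | i < 8] =
  \det M * theta u v w x [tuple f i | i < 8].
Proof. exact: (@wedge_det _ _ 4 4 _ _ M f (om_ml u v w x) (proj1 Phi_form)). Qed.

Lemma omega2E u v w x (t : 4.-tuple W) :
  wedge (iota_form v (iota_form u Phi)) (iota_form x (iota_form w Phi)) t =
  let a := F u v in let b := F w x in
  a t`_0 t`_1 * b t`_2 t`_3 - a t`_0 t`_2 * b t`_1 t`_3
   + a t`_0 t`_3 * b t`_1 t`_2 + a t`_1 t`_2 * b t`_0 t`_3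
   - a t`_1 t`_3 * b t`_0 t`_2 + a t`_2 t`_3 * b t`_0 t`_1.
Proof.
by apply: wedge22 => *; [apply: omE|apply: omE|apply: (a4C23 AF)|apply: (a4C23 AF)].
Qed.

Lemma theta_lin c u u' v w x t :
  theta (c *: u + u') v w x t = c * theta u v w x t + theta u' v w x t.
Proof.
by apply: wedge_linl => s; rewrite !omega2E /= !(a4lin AF); ring.
Qed.

Lemma theta_swap u v w x t : theta w x u v t = theta u v w x t.
Proof. by apply: eq_wedgel => s; rewrite !omega2E /=; ring. Qed.

Lemma theta_anti u v w x t : theta v u w x t = - theta u v w x t.
Proof.
(* Writing -1 as -2 + 1 makes this an instance of linearity of the wedge
   product in its first factor. *)
have -> : - theta u v w x t = - 2 * theta u v w x t + theta u v w x t by ring.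
by apply: wedge_linl => s; rewrite !omega2E /= !(a4C01 AF u v); ring.
Qed.

(** Both u and v lie in the kernel of omega_uv, so that omega_uv ^ omega_uv ^
    Phi reduces to the cube of omega_uv on the complement. *)
Lemma theta_pf u v x1 x2 x3 x4 x5 x6 :
  theta u v u v [tuple u; v; x1; x2; x3; x4; x5; x6] =
  6 * pf6 (F u v) x1 x2 x3 x4 x5 x6.
Proof.
rewrite /theta (@wedge44 _ _ (fun x y z w => 2 * pf4 (F u v) x y z w) F) //; last first.
  by move=> x y z w; rewrite omega2E /= /pf4; ring.
have F00 x y z : F x x y z = 0 by have := a4C01 AF x x y z; lra.
have F11 x y z : F x y y z = 0 by have := a4C12 AF x y y z; lra.
rewrite (@asym_rec8_pf _ _ (F u v)) ?mulrA; last 7 first.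
- exact: a4C01 AF.
- exact: a4C12 AF.
- exact: a4C23 AF.
- by move=> *; apply: a4C23 AF _ _ _ _.
- by move=> x; rewrite -[LHS]opprK -(a4C12 AF) F00 oppr0.
- by move=> x; rewrite F11.
- by [].
by field.
Qed.

End Theta.

(** * Symmetric bilinear forms on bivectors *)

(** The symmetries of a curvature tensor, except for the Bianchi identity: a
    symmetric bilinear form on bivectors. *)
Record biform (R : realType) (W : lmodType R) (Q : W -> W -> W -> W -> R) : Prop := Biform {
  bi_lin : forall c u u' v w x, Q (c *: u + u') v w x = c * Q u v w x + Q u' v w x;
  bi_anti : forall u v w x, Q v u w x = - Q u v w x;
  bi_sym : forall u v w x, Q w x u v = Q u v w x }.

Section Biform.
Variables (R : realType) (W : lmodType R) (Q : W -> W -> W -> W -> R).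
Hypothesis bQ : biform Q.
Implicit Types u v w x y z : W.

Lemma bi_lin2 c u u' v w x : Q v (c *: u + u') w x = c * Q v u w x + Q v u' w x.
Proof. by rewrite !(bi_anti bQ _ v) (bi_lin bQ); ring. Qed.
Lemma bi_lin4 c u u' v w x : Q v w x (c *: u + u') = c * Q v w x u + Q v w x u'.
Proof. by rewrite !(bi_sym bQ x _ v w) bi_lin2. Qed.
Lemma bi_zero v w x : Q 0 v w x = 0.
Proof. by have := bi_lin bQ 1 0 0 v w x; rewrite scaler0 addr0; lra. Qed.
Lemma bi_alt u w x : Q u u w x = 0.
Proof. by have := bi_anti bQ u u w x; lra. Qed.
Lemma bi_Z c u v w x : Q (c *: u) v w x = c * Q u v w x.
Proof. by have := bi_lin bQ c u 0 v w x; rewrite bi_zero !addr0. Qed.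
Lemma bi_Z2 c u v w x : Q v (c *: u) w x = c * Q v u w x.
Proof. by rewrite !(bi_anti bQ _ v) bi_Z; ring. Qed.

(** A biform depends on u, v and on w, x only through their exterior products.
    *)
Lemma bi_triangular a b c f0 f1 :
  Q (a *: f0) (b *: f0 + c *: f1) (a *: f0) (b *: f0 + c *: f1) =
  (a * c) ^+ 2 * Q f0 f1 f0 f1.
Proof.
have half w x : Q (a *: f0) (b *: f0 + c *: f1) w x = a * c * Q f0 f1 w x.
  by rewrite bi_lin2 !bi_Z !bi_Z2 bi_alt; ring.
by rewrite half -(bi_sym bQ) half; ring.
Qed.

Lemma bi_polar (P : W -> W -> W -> R) :
  (forall u c v v' w, P u (c *: v + v') w = c * P u v w + P u v' w) ->
  (forall u v w, P u w v = P u v w) ->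
  (forall u v, Q u v u v = P u v v) -> forall u v w, Q u v u w = P u v w.
Proof.
move=> Pl Ps QP u v w; have := QP u (1 *: v + w).
rewrite bi_lin2 !bi_lin4 Pl !(Ps u (_ + _)) !Pl !QP (Ps u v w) (bi_sym bQ u v u w); lra.
Qed.

End Biform.

(** * Inner products and linear independence *)

(** Inner products as bare functions, which can be rescaled and defined by
    formulas; inner_dot packages them. *)
Record inner (R : realType) (W : lmodType R) (g : W -> W -> R) : Prop := Inner {
  inn_lin : forall c x y z, g (c *: x + y) z = c * g x z + g y z;
  inn_sym : forall x y, g y x = g x y;
  inn_pos : forall x, x != 0 -> 0 < g x x }.

Section Free.
Variables (R : realType) (W : vectType R).
Implicit Types u v w : W.

Lemma free2P u v :
  (forall a b, a *: u + b *: v = 0 -> a = 0 /\ b = 0) <-> free [:: u; v].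
Proof.
split=> [H|/(@freeP _ _ _ [tuple u; v]) H a b E].
  apply/(@freeP _ _ _ [tuple u; v]) => k.
  rewrite !big_ord_recl big_ord0 addr0 => /H[k0 k1] i.
  by case: (unliftP ord0 i) => [j ->|-> //]; rewrite (ord1 j).
have := H (fun i => if i == ord0 then a else b).
rewrite !big_ord_recl big_ord0 addr0 => /(_ E) Z.
by have := Z ord0; have := Z ord_max.
Qed.

Lemma free3P u v w :
  (forall a b c, a *: u + b *: v + c *: w = 0 -> [/\ a = 0, b = 0 & c = 0])
   <-> free [:: u; v; w].
Proof.
split=> [H|/(@freeP _ _ _ [tuple u; v; w]) H a b c E].
  apply/(@freeP _ _ _ [tuple u; v; w]) => k.
  rewrite !big_ord_recl big_ord0 addr0 addrA => /H[k0 k1 k2] i.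
  case: (unliftP ord0 i) => [j ->|-> //]; case: (unliftP ord0 j) => [k' ->|-> //].
  by rewrite (ord1 k').
have := H (fun i => if i == ord0 then a else if i == ord_max then c else b).
rewrite !big_ord_recl big_ord0 addr0 addrA => /(_ E) Z.
by have := Z ord0; have := Z ord_max; have := Z (lift ord0 ord0).
Qed.

Lemma free3_12 u v w : free [:: u; v; w] -> free [:: u; v].
Proof.
move=> /free3P H; apply/free2P => a b E.
by have [|-> -> _] := H a b 0; rewrite ?scale0r ?addr0.
Qed.

Lemma free3_13 u v w : free [:: u; v; w] -> free [:: u; w].
Proof.
move=> /free3P H; apply/free2P => a b E.
by have [|-> _ ->] := H a 0 b; rewrite ?scale0r ?addr0.
Qed.

Lemma free3_132 u v w : free [:: u; v; w] -> free [:: u; w; v].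
Proof.
move=> /free3P H; apply/free3P => a b c E.
by have [|-> -> ->] := H a c b; rewrite // addrAC.
Qed.

Lemma free3_213 u v w : free [:: u; v; w] -> free [:: v; u; w].
Proof.
move=> /free3P H; apply/free3P => a b c E.
by have [|-> -> ->] := H b a c; rewrite // [X in X + _]addrC.
Qed.

End Free.

(** * From condition (C) to constant curvature *)

Section Curvature.
Variables (R : realType) (W : vectType R) (Q : W -> W -> W -> W -> R).
Hypothesis bQ : biform Q.
Hypothesis Qpos : forall u v, free [:: u; v] -> 0 < Q u v u v.
Hypothesis QC : forall u v w, free [:: u; v; w] -> Q u v u w = 0 -> Q v u v w = 0 ->
  forall x, Q u w u x = 0 <-> Q v w v x = 0.

Implicit Types u v w x y z t : W.

Let QL := bi_lin bQ.
Let QA := bi_anti bQ.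
Let QS := bi_sym bQ.

(** The polarised Jacobi operator. It forgets the totally antisymmetric part
    of Q, which condition (C) cannot see, and in return it is symmetric in each
    pair and satisfies the cyclic identity jacobi_cyc. *)
Definition jacobi_form u v w x := Q u w v x + Q v w u x.
Local Notation G := jacobi_form.

Lemma jacobi_lin1 c u u' v w x : G (c *: u + u') v w x = c * G u v w x + G u' v w x.
Proof. by rewrite /jacobi_form !(QS _ x v w) !QL; ring. Qed.

Lemma jacobi_s12 u v w x : G v u w x = G u v w x.
Proof. by rewrite /jacobi_form addrC. Qed.

Lemma jacobi_pair u v w x : G w x u v = G u v w x.
Proof.
have N a b c d : Q a b d c = - Q a b c d by rewrite QS QA QS.
by rewrite /jacobi_form (QA u w) (QA u x) !(N _ _ v) !opprK (QS v w).
Qed.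

Lemma jacobi_s34 u v w x : G u v x w = G u v w x.
Proof. by rewrite -jacobi_pair jacobi_s12 jacobi_pair. Qed.

Lemma jacobi_cyc u v w x : G u v w x + G v w u x + G w u v x = 0.
Proof. by rewrite /jacobi_form (QA v w) (QA u w) (QA u v); ring. Qed.

Lemma jacobi_lin2 c u u' v w x : G v (c *: u + u') w x = c * G v u w x + G v u' w x.
Proof. by rewrite !(jacobi_s12 _ v) jacobi_lin1. Qed.
Lemma jacobi_lin3 c u u' v w x : G v w (c *: u + u') x = c * G v w u x + G v w u' x.
Proof. by rewrite !(jacobi_pair _ x) jacobi_lin1. Qed.
Lemma jacobi_lin4 c u u' v w x : G v w x (c *: u + u') = c * G v w x u + G v w x u'.
Proof. by rewrite !(jacobi_s34 _ _ _ x) jacobi_lin3. Qed.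

Lemma jacobi_diag u v w : G u u v w = 2 * Q u v u w.
Proof. by rewrite /G; ring. Qed.

Lemma jacobi_uuu u w : G u u u w = 0.
Proof. by have := jacobi_cyc u u u w; lra. Qed.

Lemma jacobi_pos u v : free [:: u; v] -> 0 < G u u v v.
Proof. by move=> /Qpos; rewrite jacobi_diag; lra. Qed.

(** If Q u v u v were |u|^2 |v|^2 - <u, v>^2, this would say that w is
    orthogonal to the plane of u and v; see perp_shear for the dependence on the
    plane alone. *)
Definition perp u v w := G u u v w = 0 /\ G v v u w = 0.

Lemma G_C u v w x : free [:: u; v; w] -> perp u v w ->
  G u u w x = 0 -> G v v w x = 0.
Proof.
move=> fr []; rewrite !jacobi_diag => h1 h2 h3.
have p2 : (2 : R) != 0 by rewrite pnatr_eq0.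
have D (a : R) : 2 * a = 0 -> a = 0 by move/eqP; rewrite mulf_eq0 (negbTE p2) => /eqP.
by have [/(_ (D _ h3)) -> _] := QC fr (D _ h1) (D _ h2) x; rewrite mulr0.
Qed.

Lemma perp_mixed u v w : perp u v w -> G u v u w = 0 /\ G u v v w = 0.
Proof.
move=> [h1 h2]; have := jacobi_cyc u v v w; have := jacobi_cyc u u v w.
by rewrite (jacobi_s12 u v u) (jacobi_s12 u v v) h1 h2; lra.
Qed.

Lemma perp_lin u v w x c : perp u v w -> perp u v x -> perp u v (c *: w + x).
Proof. by move=> [h1 h2] [h3 h4]; split; rewrite jacobi_lin4 ?h1 ?h2 ?h3 ?h4; ring. Qed.

(** The mixed terms vanish by the cyclic identity, so that w stays in the
    complement when u and v are replaced by another basis of their plane. *)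
Lemma perp_shear u v w c : perp u v w -> perp u (c *: u + v) w.
Proof.
move=> h; have [h1 h2] := h; have [h3 h4] := perp_mixed h; split.
  by rewrite jacobi_lin3 h1 jacobi_uuu; ring.
by rewrite jacobi_lin1 !jacobi_lin2 h2 jacobi_uuu (jacobi_s12 u v) h3; ring.
Qed.

(** On the plane of u and v, the functionals G u u v and G v v u read off the
    two coordinates, and both vanish on w. *)
Lemma perp_free u v w : free [:: u; v] -> perp u v w -> w != 0 -> free [:: u; v; w].
Proof.
move=> fuv [h1 h2] w0; apply/free3P => a b c E.
have p1 := jacobi_pos fuv.
have p2 : 0 < G v v u u by rewrite jacobi_pair.
have Z0 y z t : G y z t 0 = 0.
  by have := jacobi_lin4 1 0 0 y z t; rewrite scaler0 addr0; lra.
have Z y z : G y y z (a *: u + (b *: v + c *: w)) = 0 by rewrite addrA E Z0.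
have := Z v u; have := Z u v; rewrite !jacobi_lin4 -[c *: w]addr0 !jacobi_lin4 !Z0 h1 h2.
rewrite (jacobi_s34 u u u v) !jacobi_uuu (jacobi_s34 v v v u) !jacobi_uuu => /eqP.
have -> : a * 0 + (b * G u u v v + (c * 0 + 0)) = b * G u u v v by ring.
rewrite mulf_eq0 (gt_eqF p1) orbF => /eqP b0 /eqP.
have -> : a * G v v u u + (b * 0 + (c * 0 + 0)) = a * G v v u u by ring.
rewrite mulf_eq0 (gt_eqF p2) orbF => /eqP a0.
move: E; rewrite a0 b0 !scale0r !add0r => /eqP.
by rewrite scaler_eq0 (negbTE w0) orbF => /eqP c0.
Qed.

Lemma perp_C u v w x : free [:: u; v] -> perp u v w ->
  G u u w x = 0 -> G v v w x = 0.
Proof.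
move=> fuv p h; have [->|w0] := eqVneq w 0; last exact: (G_C (perp_free fuv p w0)).
by have := jacobi_lin3 1 0 0 v v x; rewrite scaler0 addr0; lra.
Qed.

(** Condition (C) says that G u u w and G v v w have the same kernel. Applied
    to the part of x that G u u makes orthogonal to w, this turns the two
    functionals into multiples of each other. *)
Lemma conformal1 u v w x : free [:: u; v] -> perp u v w -> perp u v x ->
  G v v w x * G u u w w = G v v w w * G u u w x.
Proof.
move=> fuv pw px.
have := @perp_C u v w (- G u u w x *: w + (G u u w w *: x + 0)) fuv pw.
have Z0 y z t : G y z t 0 = 0.
  by have := jacobi_lin4 1 0 0 y z t; rewrite scaler0 addr0; lra.
rewrite !jacobi_lin4 !Z0 => H.
by have := H ltac:(ring); lra.
Qed.

(** The ratio of G v v w to G u u w is the same for all w in the complement: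
    two vectors are compared directly when G u u does not make them orthogonal,
    and through their sum when it does. *)
Lemma conformal2 u v w x : free [:: u; v] -> perp u v w -> perp u v x ->
  G v v w w * G u u x x = G v v x x * G u u w w.
Proof.
move=> fuv pw px.
have [->|w0] := eqVneq w 0.
  have Z0 y z t : G y z t 0 = 0.
    by have := jacobi_lin4 1 0 0 y z t; rewrite scaler0 addr0; lra.
  by rewrite !Z0; ring.
have gw := jacobi_pos (free3_13 (perp_free fuv pw w0)).
have E1 := conformal1 fuv pw px; have E2 := conformal1 fuv px pw.
rewrite (jacobi_s34 v v w x) (jacobi_s34 u u w x) in E2.
have [z|z] := eqVneq (G u u w x) 0.
  have pwx : perp u v (1 *: w + x) by apply: perp_lin.
  have Ez : G v v w x = 0.
    by move: E1; rewrite z mulr0 => /eqP; rewrite mulf_eq0 (gt_eqF gw) orbF => /eqP.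
  have := conformal1 fuv pwx pw.
  rewrite !jacobi_lin3 !jacobi_lin4 (jacobi_s34 v v w x) (jacobi_s34 u u w x) z Ez !mul1r !addr0 !add0r.
  by lra.
apply: (mulIf z).
have -> : G v v w w * G u u x x * G u u w x = (G v v w w * G u u w x) * G u u x x by ring.
have -> : G v v x x * G u u w w * G u u w x = (G v v x x * G u u w x) * G u u w w by ring.
by rewrite -E1 -E2; ring.
Qed.

Lemma conformal u v w0 : free [:: u; v] -> perp u v w0 -> w0 != 0 ->
  forall w x, perp u v w -> perp u v x ->
  G v v w x = G v v w0 w0 / G u u w0 w0 * G u u w x.
Proof.
move=> fuv p0 n0 w x pw px.
have g0 : G u u w0 w0 != 0 by rewrite gt_eqF // (jacobi_pos (free3_13 (perp_free fuv p0 n0))).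
have [->|nw] := eqVneq w 0.
  have Z0 y z t : G y z 0 t = 0.
    by have := jacobi_lin3 1 0 0 y z t; rewrite scaler0 addr0; lra.
  by rewrite !Z0; ring.
have gw : G u u w w != 0 by rewrite gt_eqF // (jacobi_pos (free3_13 (perp_free fuv pw nw))).
apply: (mulIf gw); rewrite (conformal1 fuv pw px).
have E := conformal2 fuv pw p0.
have -> : G v v w w = G v v w0 w0 / G u u w0 w0 * G u u w w.
  by apply: (mulIf g0); rewrite E; field.
by ring.
Qed.

Lemma G0l x y z : G 0 x y z = 0.
Proof. by have := jacobi_lin1 1 0 0 x y z; rewrite scaler0 addr0; lra. Qed.
Lemma G0r x y z : G x y z 0 = 0.
Proof. by have := jacobi_lin4 1 0 0 x y z; rewrite scaler0 addr0; lra. Qed.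

(** Starting from a triple that is orthogonal in the sense of G, the space splits
    into the plane of e0 and e1 and its complement H. Condition (C) determines
    every component of G in terms of the form h on H and of the constants D
    and rho, and the result is the curvature of the metric g below. *)
Section Frame.
Variables (e0 e1 w0 : W).
Hypotheses (fe : free [:: e0; e1]) (pe : perp e0 e1 w0) (oe : G w0 w0 e0 e1 = 0)
  (n0 : w0 != 0).

Let D := G e0 e0 e1 e1.
Let h w x := G e0 e0 w x.
Let rho := G e1 e1 w0 w0 / G e0 e0 w0 w0.
Let H w := perp e0 e1 w.

Let fr3 w : H w -> w != 0 -> free [:: e0; e1; w].
Proof. exact: perp_free. Qed.

Let D_gt0 : 0 < D. Proof. exact: jacobi_pos. Qed.

Let h_gt0 w : H w -> w != 0 -> 0 < h w w.
Proof. by move=> Hw nw; apply: jacobi_pos; apply: free3_13 (fr3 Hw nw). Qed.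

Let rho_gt0 : 0 < rho.
Proof.
apply: divr_gt0; last exact: h_gt0.
by apply: jacobi_pos; apply: free3_13 (free3_213 (fr3 pe n0)).
Qed.

Let G11 w x : H w -> H x -> G e1 e1 w x = rho * h w x.
Proof. exact: conformal. Qed.

(** Proportionality for the pair e0, e0 + e1, whose ratio is found at w0. *)
Let G01 w x : H w -> H x -> G e0 e1 w x = 0.
Proof.
move=> Hw Hx; have H' y : H y -> perp e0 (1 *: e0 + e1) y by exact: perp_shear.
have f' : free [:: e0; 1 *: e0 + e1].
  move/free2P: fe => K; apply/free2P => a b.
  rewrite scale1r scalerDr addrA -scalerDl => /K[E b0]; split=> //.
  by rewrite b0 addr0 in E.
have E := conformal f' (H' _ pe) n0 (H' _ Hw) (H' _ Hx).
have E2 := G11 Hw Hx; have h0 := h_gt0 pe n0; move: E E2; rewrite /rho /h.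
rewrite !jacobi_lin1 !jacobi_lin2 (jacobi_s12 e0 e1) (jacobi_s12 e0 e1 w0) (jacobi_pair w0 w0 e0 e1) oe => E E2.
have -> : G e0 e1 w x = (G e1 e1 w0 w0 / G e0 e0 w0 w0 * G e0 e0 w x - G e1 e1 w x) / 2.
  have z : G e0 e0 w0 w0 != 0 by rewrite gt_eqF.
  suff E' : (1 * (1 * G e0 e0 w0 w0 + 0) + (1 * 0 + G e1 e1 w0 w0)) / G e0 e0 w0 w0
      * G e0 e0 w x = G e0 e0 w x + G e1 e1 w0 w0 / G e0 e0 w0 w0 * G e0 e0 w x.
    by move: E; rewrite E'; lra.
  by field.
by rewrite E2 subrr mul0r.
Qed.

(** Condition (C) for the pair e1, w, with e0 as a vector of their complement.
    *)
Let Gww0 w x : H w -> H x -> G w w e0 x = 0.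
Proof.
move=> Hw Hx; have [->|nw] := eqVneq w 0; first by rewrite G0l.
have fr := free3_132 (free3_213 (fr3 Hw nw)).
apply: (G_C fr); last by rewrite (proj2 Hx).
by split; [rewrite jacobi_s34 (proj2 Hw)|rewrite -jacobi_pair jacobi_s12 G01].
Qed.

Let Gww1 w x : H w -> H x -> G w w e1 x = 0.
Proof.
move=> Hw Hx; have [->|nw] := eqVneq w 0; first by rewrite G0l.
have fr := free3_132 (fr3 Hw nw).
apply: (G_C fr); last by rewrite (proj1 Hx).
by split; [rewrite jacobi_s34 (proj1 Hw)|rewrite -jacobi_pair G01].
Qed.

Let perp_e1 w : H w -> perp e0 w e1.
Proof.
by move=> Hw; split; [rewrite jacobi_s34 (proj1 Hw)|rewrite -jacobi_pair G01].
Qed.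

(** Condition (C) for the pair e0, e0 + w, with e1 as a vector of their
    complement. *)
Let G0w1x w x : H w -> H x -> G e0 w e1 x = 0.
Proof.
move=> Hw Hx; have [->|nw] := eqVneq w 0; first by rewrite jacobi_s12 G0l.
have f2 : free [:: e0; 1 *: e0 + w].
  move/free2P: (free3_13 (fr3 Hw nw)) => K; apply/free2P => a b.
  rewrite scale1r scalerDr addrA -scalerDl => /K[E b0]; split=> //.
  by rewrite b0 addr0 in E.
have := perp_C f2 (perp_shear 1 (perp_e1 Hw)) (proj1 Hx).
rewrite !jacobi_lin1 !jacobi_lin2 (proj1 Hx) (Gww1 Hw Hx) (jacobi_s12 e0 w); lra.
Qed.

(** Both e1 and the part z of y orthogonal to w lie in the complement of e0
    and w. The ratio of G w w to G e0 e0 there, computed at e1, is rho * h w w /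
    D; at z it gives the claim. *)
Let Gwwyy w y : H w -> H y -> G w w y y = rho / D * (h w w * h y y - h w y ^+ 2).
Proof.
move=> Hw Hy; have [->|nw] := eqVneq w 0; first by rewrite G0l /h jacobi_s34 !G0r; ring.
have hw := h_gt0 Hw nw; have D0 := D_gt0.
pose z := (- (h w y / h w w)) *: w + y.
have Hz : H z by apply: perp_lin.
have hwz : h w z = 0 by rewrite /z /h jacobi_lin4 -/(h w w) -/(h w y); field; rewrite gt_eqF.
have pz : perp e0 w z by split; [exact: hwz|exact: Gww0].
have fw := free3_13 (fr3 Hw nw).
have := conformal2 fw pz (perp_e1 Hw); rewrite -/(h z z) -/D.
rewrite (jacobi_pair e1 e1) (G11 Hw Hw) => E.
have {E} E : G w w z z = rho * h w w * h z z / D.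
  by rewrite -E mulfK // gt_eqF.
have Ey : y = (h w y / h w w) *: w + z by rewrite /z addrA -scalerDl subrr scale0r add0r.
have Gen c z' : G w w (c *: w + z') (c *: w + z') = G w w z' z'.
  by rewrite !jacobi_lin3 !jacobi_lin4 (jacobi_s34 w w w z') !jacobi_uuu; ring.
have Gz : G w w y y = G w w z z by rewrite -(Gen (h w y / h w w) z) -Ey.
rewrite Gz E /z /h !jacobi_lin3 !jacobi_lin4 (jacobi_s34 _ _ w y); field.
by rewrite !gt_eqF.
Qed.

Let p0 y := G e1 e1 e0 y / D.
Let p1 y := G e0 e0 e1 y / D.
Let pH y := (- p0 y) *: e0 + ((- p1 y) *: e1 + y).

Let H_pH y : H (pH y).
Proof.
split; rewrite /pH !jacobi_lin4.
  rewrite (jacobi_s34 e0 e0 e0 e1) jacobi_uuu -/D /p1; field; rewrite gt_eqF //.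
rewrite (jacobi_s34 e1 e1 e1 e0) jacobi_uuu (jacobi_pair e0 e0 e1 e1) -/D /p0; field; rewrite gt_eqF //.
Qed.

Let decomp y : y = p0 y *: e0 + (p1 y *: e1 + pH y).
Proof.
rewrite /pH; set a := p0 y; set b := p1 y.
rewrite addrCA [X in _ + X]addrA -scalerDl subrr scale0r add0r.
by rewrite addrA -scalerDl subrr scale0r add0r.
Qed.

(** The products of a length in the plane with a length in H are prescribed,
    so that only a scaling of the plane against H is left to choose; G e0 e0 e1 e1
    = D fixes it. *)
Let s := Num.sqrt (D / (2 * rho)).

Let s_gt0 : 0 < s.
Proof. by rewrite sqrtr_gt0 divr_gt0 // mulr_gt0. Qed.

Let g y z := s * (p0 y * p0 z) + s * rho * (p1 y * p1 z) + (2 * s)^-1 * h (pH y) (pH z).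

Let g_inner : inner g.
Proof.
have p0L c x y : p0 (c *: x + y) = c * p0 x + p0 y.
  by rewrite /p0 jacobi_lin4; ring.
have p1L c x y : p1 (c *: x + y) = c * p1 x + p1 y.
  by rewrite /p1 jacobi_lin4; ring.
pose q y := p0 y *: e0 + p1 y *: e1.
have qL c x y : q (c *: x + y) = c *: q x + q y.
  by rewrite /q p0L p1L !scalerDl -!scalerA addrACA -scalerDr.
have pHE y : pH y = y - q y.
  by rewrite /pH !scaleNr addrA addrC opprD.
have pHL c x y : pH (c *: x + y) = c *: pH x + pH y.
  by rewrite !pHE qL opprD scalerBr addrACA.
have s0 := s_gt0; have r0 := rho_gt0.
split=> [c x y z|x y|x nx].
- rewrite /g p0L p1L pHL /h jacobi_lin3; ring.
- rewrite /g /h (jacobi_s34 _ _ (pH x)); ring.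
- have a1 : 0 <= s * (p0 x * p0 x) by rewrite -expr2 mulr_ge0 ?sqr_ge0 ?ltW.
  have a2 : 0 <= s * rho * (p1 x * p1 x).
    by rewrite -expr2 mulr_ge0 ?sqr_ge0 ?(ltW (mulr_gt0 s0 r0)).
  have s2 : 0 < (2 * s)^-1 by rewrite invr_gt0 mulr_gt0.
  have a3 : 0 <= (2 * s)^-1 * h (pH x) (pH x).
    rewrite mulr_ge0 ?(ltW s2) //; have [->|n] := eqVneq (pH x) 0.
      by rewrite /h G0r.
    exact/ltW/(h_gt0 (H_pH x) n).
  rewrite lt0r !addr_ge0 // andbT; apply: contra nx.
  have K (c a : R) : 0 < c -> (c * a == 0) = (a == 0).
    by move=> c0; rewrite mulf_eq0 (gt_eqF c0).
  have K2 (a : R) : (a * a == 0) = (a == 0) by rewrite mulf_eq0 orbb.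
  have r1 := mulr_gt0 s0 r0; rewrite !paddr_eq0 ?addr_ge0 // (K _ _ s0) (K _ _ r1) (K _ _ s2) !K2.
  move=> /andP[/andP[z0 z1] zH].
  rewrite (decomp x) (eqP z0) (eqP z1) !scale0r !add0r.
  by apply: contraTT zH => n; rewrite (gt_eqF (h_gt0 (H_pH x) n)).
Qed.

Lemma quad_expand (B : W -> W -> R) a b w :
  (forall c x y z, B (c *: x + y) z = c * B x z + B y z) ->
  (forall x y, B y x = B x y) ->
  B (a *: e0 + (b *: e1 + w)) (a *: e0 + (b *: e1 + w)) =
  a ^+ 2 * B e0 e0 + 2 * a * b * B e0 e1 + b ^+ 2 * B e1 e1
  + 2 * a * B e0 w + 2 * b * B e1 w + B w w.
Proof.
move=> Bl Bs.
by rewrite !Bl !(Bs (_ + _)) !Bl !(Bs e0 w) !(Bs e1 w) (Bs e0 e1); ring.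
Qed.

Let g_curv u v : Q u v u v = g u u * g v v - g u v ^+ 2.
Proof.
have -> : Q u v u v = G u u v v / 2 by rewrite jacobi_diag; field.
have Gq x y b c w : G x y (b *: e0 + (c *: e1 + w)) (b *: e0 + (c *: e1 + w)) =
  b ^+ 2 * G x y e0 e0 + 2 * b * c * G x y e0 e1 + c ^+ 2 * G x y e1 e1
  + 2 * b * G x y e0 w + 2 * c * G x y e1 w + G x y w w.
  by apply: quad_expand => *; [exact: jacobi_lin3|exact: jacobi_s34].
have Gq' x b c w : G (b *: e0 + (c *: e1 + w)) (b *: e0 + (c *: e1 + w)) x x =
  b ^+ 2 * G e0 e0 x x + 2 * b * c * G e0 e1 x x + c ^+ 2 * G e1 e1 x x
  + 2 * b * G e0 w x x + 2 * c * G e1 w x x + G w w x x.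
  apply: (quad_expand (B := fun y z => G y z x x)) => *; [exact: jacobi_lin1|exact: jacobi_s12].
have Gv y z := Gq y z (p0 v) (p1 v) (pH v).
have := Gq' v (p0 u) (p1 u) (pH u); rewrite -(decomp u) => ->.
rewrite -(decomp v) in Gv; rewrite !Gv /g {Gq Gq' Gv}.
set w := pH u; set x := pH v.
have Hw : H w by exact: H_pH. have Hx : H x by exact: H_pH.
have E01 : G e0 e1 e0 e1 = - D / 2.
  by have := jacobi_cyc e0 e1 e0 e1; rewrite (jacobi_s12 e0 e1) -/D; lra.
have E0w : G e0 w e0 x = - h w x / 2.
  by have := jacobi_cyc e0 w e0 x; rewrite (jacobi_s12 e0 w) -/(h w x); lra.
have E1w : G e1 w e1 x = - (rho * h w x) / 2.
  by have := jacobi_cyc e1 w e1 x; rewrite (jacobi_s12 e1 w) (G11 Hw Hx); lra.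
have [a0 a1] := perp_mixed Hx; have [b0 b1] := perp_mixed Hw.
have [c0 c1] := Hx; have [d0 d1] := Hw.
rewrite E01 E0w E1w !jacobi_uuu -/D (jacobi_pair e0 e0 e1 e1) -/D a0 a1 c0 c1.
rewrite (jacobi_pair e0 e0 e0 e1) (jacobi_pair e1 e1 e0 e1) (jacobi_s34 e1 e1 e1 e0) !jacobi_uuu.
rewrite (jacobi_pair e0 e0 e0 w) (jacobi_pair e0 e1 e0 w) (jacobi_pair e1 e1 e0 w) !jacobi_uuu b0 d1.
rewrite (jacobi_pair e0 e0 e1 w) (jacobi_pair e0 e1 e1 w) (jacobi_pair e1 e1 e1 w) !jacobi_uuu b1 d0.
rewrite (jacobi_pair x x e0 w) (jacobi_pair x x e1 w) (Gww0 Hx Hw) (Gww1 Hx Hw).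
rewrite (Gww0 Hw Hx) (Gww1 Hw Hx) (G0w1x Hw Hx) (jacobi_pair e0 x e1 w) (G0w1x Hx Hw).
rewrite (jacobi_pair e0 e0 w w) (jacobi_pair e0 e1 w w) (jacobi_pair e1 e1 w w) (G01 Hw Hw) (G01 Hx Hx).
rewrite (G11 Hw Hw) (G11 Hx Hx) (Gwwyy Hw Hx) -/(h w w) -/(h x x).
have s0 := s_gt0; have r0 := rho_gt0.
have DE : D = 2 * rho * s ^+ 2.
  rewrite sqr_sqrtr; first by field; rewrite gt_eqF.
  by rewrite ltW // divr_gt0 // mulr_gt0.
rewrite DE; move: s0 r0; move: (s) (rho) (h w w) (h w x) (h x x) (p0 u) (p1 u) (p0 v) (p1 v).
move=> S P hww hwx hxx u0 u1 v0 v1 S0 P0; field.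
by rewrite !gt_eqF.
Qed.

Lemma inner_of_frame : exists g, inner g /\
  forall u v, Q u v u v = g u u * g v v - g u v ^+ 2.
Proof. by exists g; split; [exact: g_inner|exact: g_curv]. Qed.

End Frame.

(** An orthogonal triple exists: project x to the complement of u and v, then
    shear v within the plane. *)
Lemma inner_of_curvature : (exists u v w : W, free [:: u; v; w]) ->
  exists g, inner g /\ forall u v, Q u v u v = g u u * g v v - g u v ^+ 2.
Proof.
move=> [u [v [x fr]]].
have fuv := free3_12 fr; have D0 := jacobi_pos fuv.
pose D := G u u v v.
pose w := (- (G v v u x / D)) *: u + ((- (G u u v x / D)) *: v + x).
have pw : perp u v w.
  split; rewrite /w !jacobi_lin4.
    rewrite (jacobi_s34 u u u v) jacobi_uuu /D; field; rewrite gt_eqF //.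
  rewrite (jacobi_s34 v v v u) jacobi_uuu (jacobi_pair u u v v) /D; field; rewrite gt_eqF //.
have nw : w != 0.
  apply/eqP => w0; have /free3P/(_ _ _ 1) := fr.
  move/(_ (- (G v v u x / D)) (- (G u u v x / D))); rewrite scale1r -addrA -/w w0.
  by case=> // _ _ /eqP; rewrite oner_eq0.
pose c := - (G w w u v / G w w u u).
have gw : 0 < G w w u u by rewrite jacobi_pair; apply: jacobi_pos (free3_13 (perp_free fuv pw nw)).
have f' : free [:: u; c *: u + v].
  move/free2P: fuv => K; apply/free2P => a b.
  rewrite scalerDr addrA scalerA -scalerDl => /K[E b0]; split=> //.
  by rewrite b0 mul0r addr0 in E.
apply: (inner_of_frame f' (perp_shear c pw) _ nw).
by rewrite jacobi_lin4 /c; field; rewrite gt_eqF.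
Qed.

End Curvature.

(** * Orthonormal sequences *)

Section Inner.
Variables (R : realType) (W : lmodType R) (g : W -> W -> R).
Hypothesis ig : inner g.
Implicit Types x y z : W.

Lemma innD x y z : g (x + y) z = g x z + g y z.
Proof. by have := inn_lin ig 1 x y z; rewrite scale1r mul1r. Qed.
Lemma inn0 z : g 0 z = 0.
Proof. by have := innD 0 0 z; rewrite addr0; lra. Qed.
Lemma innZ c x z : g (c *: x) z = c * g x z.
Proof. by have := inn_lin ig c x 0 z; rewrite inn0 !addr0. Qed.
Lemma innDr x y z : g z (x + y) = g z x + g z y.
Proof. by rewrite !(inn_sym ig _ z) innD. Qed.
Lemma inn0r z : g z 0 = 0.
Proof. by rewrite (inn_sym ig) inn0. Qed.
Lemma innZr c x z : g z (c *: x) = c * g z x.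
Proof. by rewrite !(inn_sym ig _ z) innZ. Qed.
Lemma inn_suml I (r : seq I) (P : pred I) (f : I -> W) z :
  g (\sum_(i <- r | P i) f i) z = \sum_(i <- r | P i) g (f i) z.
Proof. exact: (big_morph (g^~ z) (fun x y => innD x y z) (inn0 z)). Qed.
Lemma inn_sumr I (r : seq I) (P : pred I) (f : I -> W) z :
  g z (\sum_(i <- r | P i) f i) = \sum_(i <- r | P i) g z (f i).
Proof. exact: (big_morph (g z) (fun x y => innDr x y z) (inn0r z)). Qed.

Lemma inn_ge0 x : 0 <= g x x.
Proof. by have [->|/(inn_pos ig)/ltW//] := eqVneq x 0; rewrite inn0. Qed.
Lemma inn_eq0 x : g x x = 0 -> x = 0.
Proof. by move=> E; apply/eqP; apply: contraT => /(inn_pos ig); rewrite E ltxx. Qed.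

Lemma inn_inj x y : (forall z, g x z = g y z) -> x = y.
Proof.
move=> E; apply/eqP; rewrite -subr_eq0 -scaleN1r addrC; apply/eqP; apply: inn_eq0.
by rewrite (inn_lin ig) E; ring.
Qed.

End Inner.

Section Orthonormal.
Variables (R : realType) (W : vectType R).
Variable (g : W -> W -> R).
Hypothesis ig : inner g.
Implicit Types (x y z : W) (s : seq W).

Definition orthonormal_seq s :=
  forall i j, (i < size s)%N -> (j < size s)%N -> g s`_i s`_j = (i == j)%:R.

Lemma orthonormal_seq_free s : orthonormal_seq s -> free s.
Proof.
move=> on; apply/(@freeP _ _ _ (in_tuple s)) => k E i.
have := congr1 (g^~ s`_i) E; rewrite (inn0 ig) (inn_suml ig).
rewrite (bigD1 i) //= (innZ ig) on // eqxx mulr1 big1 ?addr0 // => j nji.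
by rewrite (innZ ig) on // (inj_eq val_inj) (negbTE nji) mulr0.
Qed.

Lemma orthonormal_seq_rcons s f : orthonormal_seq s -> (forall i, (i < size s)%N -> g f s`_i = 0) ->
  g f f = 1 -> orthonormal_seq (rcons s f).
Proof.
move=> on fo f1 i j; rewrite size_rcons !ltnS !nth_rcons.
rewrite leq_eqVlt [(j <= _)%N]leq_eqVlt => /orP[/eqP->|li] /orP[/eqP->|lj].
- by rewrite ltnn !eqxx.
- by rewrite ltnn eqxx lj fo // gtn_eqF.
- by rewrite ltnn eqxx li (inn_sym ig) fo // ltn_eqF.
- by rewrite li lj on.
Qed.

Hypothesis dimW : \dim {: W} = 8%N.

(** A Gram-Schmidt step that also prescribes the direction: the new vector
    lies along y, and y = 0 leaves it free. *)
Lemma orthonormal_seq_ext s y : orthonormal_seq s -> (size s < 8)%N ->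
  (forall i, (i < size s)%N -> g y s`_i = 0) ->
  exists f b, [/\ orthonormal_seq (rcons s f), y = b *: f & 0 <= b].
Proof.
move=> on sz yo.
have unit z : z != 0 -> (forall i, (i < size s)%N -> g z s`_i = 0) ->
    exists f b, [/\ orthonormal_seq (rcons s f), z = b *: f & 0 <= b].
  move=> nz zo; have gz := inn_pos ig nz; pose b := Num.sqrt (g z z).
  have b0 : 0 < b by rewrite sqrtr_gt0.
  exists (b^-1 *: z), b; split; last exact: ltW.
    apply: orthonormal_seq_rcons => // [i li|]; first by rewrite (innZ ig) zo ?mulr0.
    rewrite (innZ ig) (innZr ig) -[g z z]sqr_sqrtr ?ltW // -/b; field.
    by rewrite gt_eqF.
  by rewrite scalerA divff ?scale1r // gt_eqF.
have [y0|] := eqVneq y 0; last by move=> ny; apply: unit.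
suff [z nz zo] : exists2 z, z != 0 & forall i, (i < size s)%N -> g z s`_i = 0.
  have [f [b [of_ _ _]]] := unit z nz zo.
  by exists f, 0; rewrite scale0r y0.
have /subvPn[z _ zs] : ~~ ({: W} <= <<s>>)%VS.
  apply/negP => /dimvS; rewrite dimW leqNgt => /negP; apply.
  exact: leq_ltn_trans (dim_span s) sz.
pose p := \sum_(i < size s) g z s`_i *: s`_i.
exists (-1 *: p + z).
  rewrite scaleN1r addrC subr_eq0; apply: contraNneq zs => ->.
  by apply: memv_suml => i _; apply: memvZ; apply: memv_span; apply: mem_nth.
move=> i li; rewrite (inn_lin ig) (inn_suml ig) (bigD1 (Ordinal li)) //=.
rewrite (innZ ig) on // eqxx mulr1 big1 => [|j nj]; first by rewrite /=; ring.
rewrite (innZ ig) on //; case: eqP => [E|]; last by rewrite mulr0.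
by case/eqP: nj; apply: val_inj.
Qed.

Lemma orthonormal_seq_extend s n : orthonormal_seq s -> (size s + n = 8)%N ->
  exists r, size r = n /\ orthonormal_seq (s ++ r).
Proof.
elim: n s => [|n IH] s on sz; first by exists [::]; rewrite cats0.
have [||f [_ [on' _ _]]] := @orthonormal_seq_ext s 0 on.
- by rewrite -sz addnS ltnS leq_addr.
- by move=> i _; rewrite (inn0 ig).
have [|r [sr onr]] := IH _ on'; first by rewrite size_rcons addSnnS.
by exists (f :: r); rewrite /= sr -cat_rcons.
Qed.

Lemma onb_expand s z : orthonormal_seq s -> size s = 8%N -> z = \sum_(i < 8) g z s`_i *: s`_i.
Proof.
move=> on sz; have fs := orthonormal_seq_free on.
have bs : basis_of {: W} s.
  by rewrite basisEfree fs subvf dimW sz leqnn.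
pose t := Tuple (introT eqP sz).
have /coord_span E : z \in <<t>>%VS by rewrite (span_basis bs) memvf.
rewrite [LHS]E; apply: eq_bigr => i _; congr (_ *: _).
rewrite [in RHS]E (inn_suml ig) (bigD1 i) //= (innZ ig) on ?sz // eqxx mulr1.
rewrite big1 ?addr0 // => j nj; rewrite (innZ ig) on ?sz //.
by rewrite (inj_eq val_inj) (negbTE nj) mulr0.
Qed.

Lemma onb_parseval s z z' : orthonormal_seq s -> size s = 8%N ->
  g z z' = \sum_(i < 8) g z s`_i * g z' s`_i.
Proof.
move=> on sz; rewrite {1}(onb_expand z on sz) (inn_suml ig).
by apply: eq_bigr => i _; rewrite (innZ ig) (inn_sym ig z').
Qed.

Lemma riesz (l : W -> R) : (forall c x y, l (c *: x + y) = c * l x + l y) ->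
  exists y, forall z, g y z = l z.
Proof.
move=> ll; have [|//|r [sr onr]] := @orthonormal_seq_extend [::] 8; first by [].
have l0 : l 0 = 0 by have := ll 1 0 0; rewrite scaler0 addr0; lra.
exists (\sum_(i < 8) l r`_i *: r`_i) => z.
rewrite (inn_suml ig) {2}(onb_expand z onr sr).
have lD x y : l (x + y) = l x + l y by rewrite -[x]scale1r ll mul1r scale1r.
rewrite (big_morph l lD l0); apply: eq_bigr => i _.
by rewrite (innZ ig) -[_ *: _]addr0 ll l0 addr0 mulrC (inn_sym ig).
Qed.

End Orthonormal.

(** * Orthonormal bases adapted to a 4-form *)

Section Alt4More.
Variables (R : realType) (W : lmodType R) (F : W -> W -> W -> W -> R).
Hypothesis AF : alt4form F.
Lemma a4lin2 c x y u v w : F u (c *: x + y) v w = c * F u x v w + F u y v w.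
Proof. by rewrite !(a4C01 AF _ u) (a4lin AF); ring. Qed.
Lemma a4lin3 c x y u v w : F u v (c *: x + y) w = c * F u v x w + F u v y w.
Proof. by rewrite !(a4C12 AF _ _ v) a4lin2; ring. Qed.
Lemma a4lin4 c x y u v w : F u v w (c *: x + y) = c * F u v w x + F u v w y.
Proof. by rewrite !(a4C23 AF _ _ _ w) a4lin3; ring. Qed.
Lemma a4_00 x y z : F x x y z = 0.
Proof. by have := a4C01 AF x x y z; lra. Qed.
Lemma a4_11 x y z : F x y y z = 0.
Proof. by have := a4C12 AF x y y z; lra. Qed.
Lemma a4_22 x y z : F x y z z = 0.
Proof. by have := a4C23 AF x y z z; lra. Qed.
Lemma a4_02 x y z : F x y x z = 0.
Proof. by rewrite (a4C01 AF) a4_11 oppr0. Qed.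
Lemma a4_13 x y z : F x y z y = 0.
Proof. by rewrite (a4C23 AF) a4_11 oppr0. Qed.
Lemma a4_03 x y z : F x y z x = 0.
Proof. by rewrite (a4C01 AF) a4_13 oppr0. Qed.
Lemma a4Z c x u v w : F (c *: x) u v w = c * F x u v w.
Proof.
have F0 : F 0 u v w = 0 by have := a4lin AF 1 0 0 u v w; rewrite scaler0 addr0; lra.
by have := a4lin AF c x 0 u v w; rewrite !addr0 F0 addr0.
Qed.
Lemma a4Z2 c x u v w : F u (c *: x) v w = c * F u x v w.
Proof. by rewrite !(a4C01 AF _ u) a4Z; ring. Qed.
Lemma a4Z3 c x u v w : F u v (c *: x) w = c * F u v x w.
Proof. by rewrite !(a4C12 AF _ _ v) a4Z2; ring. Qed.
End Alt4More.

Section Adapted.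
Variables (R : realType) (W : vectType R).
Hypothesis dimW : \dim {: W} = 8%N.
Variable (g : W -> W -> R).
Hypothesis ig : inner g.
Variable F : W -> W -> W -> W -> R.
Hypothesis AF : alt4form F.
Implicit Types (x y z : W) (s : seq W).

Notation orthonormal_seq := (orthonormal_seq g).

(** Take f3 along the functional F f0 f1 f2, any f4, then f5 along the part of
    F f0 f1 f4 orthogonal to f3. The Pfaffian of F f0 f1 on the other six vectors
    is then a product of three entries. *)
Lemma adapted f0 f1 f2 : orthonormal_seq [:: f0; f1; f2] ->
  exists f3 f4 f5 f6 f7 b,
  [/\ orthonormal_seq [:: f0; f1; f2; f3; f4; f5; f6; f7],
      forall z, F f0 f1 f2 z = b * g f3 z,
      F f0 f1 f4 f6 = 0, F f0 f1 f4 f7 = 0 &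
      pf6 (F f0 f1) f2 f3 f4 f5 f6 f7 = F f0 f1 f2 f3 * F f0 f1 f4 f5 * F f0 f1 f6 f7].
Proof.
move=> on3.
have ext s y := @orthonormal_seq_ext _ _ g ig dimW s y.
have [y3 y3P] := riesz ig dimW (fun c x y => a4lin4 AF c x y f0 f1 f2).
have [//||f3 [b [on4 y3E _]]] := ext _ y3 on3.
  by move=> [|[|[|//]]] _ /=; rewrite y3P ?(a4_03 AF) ?(a4_13 AF) ?(a4_22 AF).
have F3 z : F f0 f1 f2 z = b * g f3 z by rewrite -y3P y3E (innZ ig).
have [//||f4 [_ [on5 _ _]]] := ext _ 0 on4.
  by move=> i _; rewrite (inn0 ig).
have [y5 y5P] := riesz ig dimW (fun c x y => a4lin4 AF c x y f0 f1 f4).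
have g3 i : (i < 5)%N -> g f3 [:: f0; f1; f2; f3; f4]`_i = (3 == i)%:R.
  by move=> li; rewrite -(on5 3 i).
have F2 z : z \in [:: f0; f1; f2; f4] -> F f0 f1 f2 z = 0.
  rewrite F3 !inE => /or4P[] /eqP->.
  - by rewrite (g3 0%N) // mulr0.
  - by rewrite (g3 1%N) // mulr0.
  - by rewrite (g3 2%N) // mulr0.
  - by rewrite (g3 4%N) // mulr0.
have [//||f5 [c [on6 y5E _]]] := ext _ (- g y5 f3 *: f3 + y5) on5.
  move=> i li; rewrite (inn_lin ig) g3 // !y5P; move: i li => [|[|[|[|[|//]]]]] _ /=.
  - by rewrite (a4_03 AF); ring.
  - by rewrite (a4_13 AF); ring.
  - by rewrite (a4C23 AF f0 f1 f2 f4) F2 ?inE ?eqxx ?orbT //; ring.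
  - by rewrite mulr1 addNr.
  - by rewrite (a4_22 AF); ring.
have F4 z : F f0 f1 f4 z = c * g f5 z + g y5 f3 * g f3 z.
  by rewrite -y5P -(innZ ig) -y5E (inn_lin ig); ring.
have [//||f6 [_ [on7 _ _]]] := ext _ 0 on6.
  by move=> i _; rewrite (inn0 ig).
have [//||f7 [_ [on8 _ _]]] := ext _ 0 on7.
  by move=> i _; rewrite (inn0 ig).
exists f3, f4, f5, f6, f7, b.
have G i j := on8 i j.
have F46 : F f0 f1 f4 f6 = 0 by rewrite F4 (G 5%N 6%N) // (G 3%N 6%N) //=; ring.
have F47 : F f0 f1 f4 f7 = 0 by rewrite F4 (G 5%N 7%N) // (G 3%N 7%N) //=; ring.
split=> //.
rewrite /pf6 /pf4 F46 F47 !(F3 f4) !(F3 f5) !(F3 f6) !(F3 f7).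
by rewrite (G 3%N 4%N) // (G 3%N 5%N) // (G 3%N 6%N) // (G 3%N 7%N) //=; ring.
Qed.

(** The diagonal coefficients may vanish, so that dependent vectors are
    covered too. *)
Lemma gram_schmidt3 u v w : exists f0 f1 f2 a b c d k l,
  [/\ orthonormal_seq [:: f0; f1; f2], u = a *: f0, v = b *: f0 + c *: f1 &
      w = d *: f0 + (k *: f1 + l *: f2)].
Proof.
have on0 : orthonormal_seq [::] by [].
have [//|//|f0 [a [on1 uE _]]] := orthonormal_seq_ext ig dimW (y := u) on0.
have [//||f1 [c [on2 vE _]]] := orthonormal_seq_ext ig dimW (y := - g v f0 *: f0 + v) on1.
  move=> [|//] _; rewrite (inn_lin ig) (on1 0%N 0%N) //=; ring.
have [//||f2 [l [on3 wE _]]] :=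
  orthonormal_seq_ext ig dimW (y := - g w f0 *: f0 + (- g w f1 *: f1 + w)) on2.
  move=> [|[|//]] _; rewrite !(inn_lin ig) !(on2 0%N _) ?(on2 1%N _) //=; ring.
exists f0, f1, f2, a, (g v f0), c, (g w f0), (g w f1), l; split=> //.
  by rewrite -vE addrA -scalerDl subrr scale0r add0r.
by rewrite -wE addrCA [X in _ + X]addrA -scalerDl subrr scale0r add0r addrA
  -scalerDl subrr scale0r add0r.
Qed.

Lemma triangular_free a b c (f0 f1 : W) :
  free [:: a *: f0; b *: f0 + c *: f1] -> a != 0 /\ c != 0.
Proof.
move=> /free2P fr.
have a0 : a != 0.
  apply/eqP => z; have [|] := fr 1 0; first by rewrite z !scale0r scaler0 add0r.
  by move/eqP; rewrite oner_eq0.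
split=> //; apply/eqP => z.
have [|_] := fr (- b) a; last by move/eqP; rewrite (negbTE a0).
by rewrite z scale0r addr0 !scalerA -scalerDl mulNr mulrC addNr scale0r.
Qed.

End Adapted.

Section ThetaBasis.
Variables (R : realType) (W : vectType R).
Hypothesis dimW : \dim {: W} = 8%N.
Variable (g : W -> W -> R).
Hypothesis ig : inner g.
Variable Phi : 4.-tuple W -> R.
Hypothesis Phi_form : alternating_form Phi.
Let F x y z w := Phi [tuple x; y; z; w].

(** A change of basis multiplies all the forms theta by the same determinant,
    a sign if both bases are orthonormal. *)
Lemma theta_basis (e t : 8.-tuple W) : orthonormal_seq g e -> exists c,
  (forall u v w x, theta Phi u v w x t = c * theta Phi u v w x e) /\
  (orthonormal_seq g t -> c ^+ 2 = 1).
Proof.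
move=> one; pose M := \matrix_(i < 8, j < 8) g (tnth t i) (tnth e j).
exists (\det M); split=> [u v w x|ont].
  have -> : t = [tuple \sum_j M i j *: tnth e j | i < 8].
    apply: eq_from_tnth => i; rewrite tnth_mktuple.
    rewrite [LHS](onb_expand ig dimW _ one (size_tuple e)).
    by apply: eq_bigr => j _; rewrite mxE (tnth_nth 0 e).
  rewrite theta_det //; congr (_ * theta _ _ _ _ _ _).
  by apply: eq_from_tnth => i; rewrite tnth_mktuple.
rewrite expr2 -{2}det_tr -det_mulmx.
rewrite (_ : M *m M^T = 1%:M) ?det1 //; apply/matrixP => i j; rewrite !mxE.
rewrite -val_eqE -(ont i j) ?size_tuple // -!tnth_nth.
rewrite (onb_parseval ig dimW _ _ one (size_tuple e)).
by apply: eq_bigr => k _; rewrite !mxE (tnth_nth 0 e).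
Qed.

Lemma theta_zero (e : 8.-tuple W) u v w x : orthonormal_seq g e ->
  theta Phi u v w x e = 0 <-> theta Phi u v w x =1 (fun=> 0).
Proof.
move=> one; split=> [E t|->//].
by have [c [-> _]] := theta_basis t one; rewrite E mulr0.
Qed.

End ThetaBasis.

(** * Definiteness *)

Section Definite.
Variables (R : realType) (W : vectType R) (Q : W -> W -> W -> W -> R).
Hypothesis bQ : biform Q.
Hypothesis Qne0 : forall u v, free [:: u; v] -> Q u v u v != 0.
Implicit Types u v w x y z : W.

Let K u v := Q u v u v.

Let K_sym u v : K v u = K u v.
Proof. by rewrite /K (bi_anti bQ u v v u) -(bi_sym bQ u v v u) (bi_anti bQ u v u v) opprK. Qed.

Lemma biform_dependent u v : ~~ free [:: u; v] -> K u v = 0.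
Proof.
move=> nf; apply/eqP; apply: contraNT nf => k0; apply/free2P => a b E.
have [a0|na] := eqVneq a 0.
  have [b0|nb] := eqVneq b 0; first by [].
  move: E; rewrite a0 scale0r add0r => /eqP; rewrite scaler_eq0 (negbTE nb) /= => /eqP v0.
  by move: k0; rewrite v0 K_sym /K (bi_zero bQ) eqxx.
have uE : u = (- (b / a)) *: v.
  apply: (scalerI na); rewrite scalerA mulrN mulrCA divff // mulr1 scaleNr.
  by apply/eqP; rewrite -addr_eq0 E.
by move: k0; rewrite uE /K (bi_Z bQ) (bi_alt bQ) mulr0 eqxx.
Qed.

(** If K u w were negative, the quadratic polynomial K u (t *: w + v) in t
    would have a real root, and at a root the two vectors are independent. *)
Lemma biform_same_sign u v w : 0 < K u v -> 0 <= K u w.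
Proof.
move=> p; rewrite leNgt; apply/negP => n.
pose A := K u w; pose B := Q u v u w; pose C := K u v.
have disc : 0 < B ^+ 2 - A * C by have := sqr_ge0 B; rewrite /A /C; nra.
pose t := (- B + Num.sqrt (B ^+ 2 - A * C)) / A.
have A0 : A != 0 by rewrite lt_eqF.
have t0 : A * t ^+ 2 + 2 * B * t + C = 0.
  have := sqr_sqrtr (ltW disc); rewrite /t; move: (Num.sqrt _) => r rE.
  have -> : C = (B ^+ 2 - r ^+ 2) / A by rewrite rE; field.
  by field.
have Kt : K u (t *: w + v) = 0.
  rewrite -t0 /K (bi_lin2 bQ) !(bi_lin4 bQ) -/(K u v) -/(K u w) (bi_sym bQ u v).
  by rewrite /A /B /C; ring.
have fuv : free [:: u; v].
  by apply: contraTT (p) => /biform_dependent ->; rewrite ltxx.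
suff fr : free [:: u; t *: w + v] by have := Qne0 fr; rewrite -/(K _ _) Kt eqxx.
apply/free2P => a b E; have [b0|nb] := eqVneq b 0.
  split=> //; have /free2P/(_ a 0) := fuv; rewrite scale0r addr0.
  by move: E; rewrite b0 scale0r addr0 => E /(_ E)[].
have vE : v = (- (a / b)) *: u + (- t) *: w.
  apply: (scalerI nb); rewrite scalerDr !scalerA mulrN (mulrCA b) divff // mulr1 scaleNr.
  move/eqP: E; rewrite addrC addr_eq0 => /eqP <-.
  by rewrite scalerDr scalerA addrAC -scalerDl mulrN subrr scale0r add0r.
have := bi_triangular bQ 1 (- (a / b)) (- t) u w; rewrite scale1r -vE => T.
by move: p n; rewrite /K T => p n; have := sqr_ge0 (1 * - t); nra.
Qed.

(** Signs propagate from one pair to the next because K u v = K v u. *)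
Lemma biform_positive u0 v0 : 0 < K u0 v0 -> forall u v, free [:: u; v] -> 0 < K u v.
Proof.
move=> p u v fuv; rewrite lt0r Qne0 //=.
have [f0|] := boolP (free [:: u; u0]).
  apply: (@biform_same_sign _ u0); rewrite lt0r Qne0 //= K_sym.
  exact: biform_same_sign p.
rewrite free_cons seq1_free span_seq1 negb_and negbK => /orP[/vlineP[c ->]|].
  have := bi_triangular bQ c 0 1 u0 v; rewrite scale0r add0r scale1r /K => ->.
  by apply: mulr_ge0; [exact: sqr_ge0|exact: biform_same_sign p].
by rewrite negbK => /eqP u00; move: p; rewrite u00 /K (bi_zero bQ) ltxx.
Qed.

End Definite.

Lemma biform_definite (R : realType) (W : vectType R) (Q : W -> W -> W -> W -> R) :
  biform Q -> (forall u v, free [:: u; v] -> Q u v u v != 0) ->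
  exists s : R, s ^+ 2 = 1 /\ forall u v, free [:: u; v] -> 0 < s * Q u v u v.
Proof.
move=> bQ Q0.
have [[u0 [v0 f0]]|none] := pselect (exists u v : W, free [:: u; v]); last first.
  by exists 1; rewrite expr1n; split=> // u v fr; case: none; exists u, v.
exists (Num.sg (Q u0 v0 u0 v0)); split.
  by rewrite sqr_sg Q0.
apply: (@biform_positive _ _ (fun u v w x => Num.sg (Q u0 v0 u0 v0) * Q u v w x) _ _ u0 v0).
- split=> [c u u' v w x|u v w x|u v w x].
  + by rewrite (bi_lin bQ); ring.
  + by rewrite (bi_anti bQ u v); ring.
  + by rewrite (bi_sym bQ).
- by move=> u v fr; rewrite mulf_neq0 ?sgr_eq0 ?Q0.
- by rewrite -normrEsg normr_gt0 Q0.
Qed.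

(** * The curvature of a nondegenerate 4-form *)

Section Curv.
Variables (R : realType) (W : vectType R).
Hypothesis dimW : \dim {: W} = 8%N.
Variable Phi : 4.-tuple W -> R.
Hypothesis Phi_form : alternating_form Phi.
Let F x y z w := Phi [tuple x; y; z; w].
Let AF : alt4form F := alt4form_of Phi_form.
Implicit Types (u v w x y z : W).

Lemma theta_biform e : biform (fun u v w x => theta Phi u v w x e).
Proof.
by split=> *; [exact: theta_lin|exact: theta_anti|exact: theta_swap].
Qed.

Lemma exists_inner : exists g : W -> W -> R, inner g.
Proof.
pose b := vbasis {: W}.
exists (fun x y => \sum_i coord b i x * coord b i y); split=> [c x y z|x y|x nx].
- by rewrite big_distrr -big_split; apply: eq_bigr => i _ /=; rewrite linearP /=; ring.
- by apply: eq_bigr => i _; rewrite mulrC.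
- rewrite lt0r sumr_ge0 ?andbT => [|i _]; last by rewrite -expr2 sqr_ge0.
  apply: contra nx; rewrite psumr_eq0 => [/allP z|i _]; last by rewrite -expr2 sqr_ge0.
  rewrite (coord_vbasis (memvf x)) big1 // => i _.
  have := z i (mem_index_enum _); rewrite mulf_eq0 orbb => /eqP.
  by rewrite -/b => ->; rewrite scale0r.
Qed.

Section Metric.
Variable (g : W -> W -> R).
Hypothesis ig : inner g.

Lemma exists_onb : exists e : 8.-tuple W, orthonormal_seq g e.
Proof.
have [|//|r [sr onr]] := @orthonormal_seq_extend _ _ g ig dimW [::] 8; first by [].
by exists (Tuple (introT eqP sr)).
Qed.

Lemma linear_zero (l : W -> R) (f : seq W) : orthonormal_seq g f -> size f = 8%N ->
  (forall c x y, l (c *: x + y) = c * l x + l y) ->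
  (forall i, (i < 8)%N -> l f`_i = 0) -> forall z, l z = 0.
Proof.
move=> on sz ll l0 z; rewrite (onb_expand ig dimW z on sz).
have l00 : l 0 = 0 by have := ll 1 0 0; rewrite scaler0 addr0; lra.
have lD x y : l (x + y) = l x + l y by rewrite -[x]scale1r ll mul1r scale1r.
rewrite (big_morph l lD l00) big1 // => i _.
by rewrite -[_ *: _]addr0 ll l00 l0 // mulr0 addr0.
Qed.

Variable e : 8.-tuple W.
Hypothesis one : orthonormal_seq g e.

Lemma theta_adapted f0 f1 f2 : orthonormal_seq g [:: f0; f1; f2] ->
  exists f3 f4 f5 f6 f7 b s,
  [/\ [/\ orthonormal_seq g [:: f0; f1; f2; f3; f4; f5; f6; f7],
      forall z, F f0 f1 f2 z = b * g f3 z,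
      F f0 f1 f4 f6 = 0 & F f0 f1 f4 f7 = 0], s ^+ 2 = 1 &
      theta Phi f0 f1 f0 f1 e = s * (6 * (b * F f0 f1 f4 f5 * F f0 f1 f6 f7))].
Proof.
move=> on3; have [f3 [f4 [f5 [f6 [f7 [b [on8 F3 F46 F47 pfE]]]]]]] := adapted dimW ig AF on3.
pose t : 8.-tuple W := [tuple f0; f1; f2; f3; f4; f5; f6; f7].
have [s [sE s1]] := theta_basis dimW ig Phi_form e (e := t) on8.
exists f3, f4, f5, f6, f7, b, s; split=> //; first exact: s1.
by rewrite sE theta_pf // pfE F3 (on8 3%N 3%N) // mulr1.
Qed.

(** If one of the three factors of the Pfaffian in an adapted basis were zero,
    a combination of f2, f4 and f6 would lie in the kernel of Phi(f0, f1, ., .),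
    against nondegeneracy. *)
Lemma nondegenerate_theta u v : nondegenerate_form Phi -> free [:: u; v] ->
  theta Phi u v u v e != 0.
Proof.
move=> nd fr.
have [f0 [f1 [f2 [a [b [c [_ [_ [_ [on3 uE vE _]]]]]]]]]] := gram_schmidt3 dimW ig u v 0.
have [a0 c0] : a != 0 /\ c != 0 by apply: (@triangular_free _ _ a b c f0 f1); rewrite -uE -vE.
rewrite uE vE (bi_triangular (theta_biform e)).
apply: mulf_neq0; first by rewrite sqrf_eq0 mulf_neq0.
have [f3 [f4 [f5 [f6 [f7 [k [s [[on8 F3 F46 F47] s2 ->]]]]]]]] := theta_adapted on3.
have s0 : s != 0 by rewrite -sqrf_eq0 s2 oner_eq0.
have G i j := on8 i j.
pose f := [:: f0; f1; f2; f3; f4; f5; f6; f7].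
have ndz z : free [:: f0; f1; z] -> (forall i, (i < 8)%N -> F f0 f1 z f`_i = 0) -> False.
  move=> /nd[x /eqP Fx] l0; apply: Fx.
  by apply: (linear_zero on8 _ (fun c x y => a4lin4 AF c x y f0 f1 z)).
have F2 i : (i < 8)%N -> F f0 f1 f2 f`_i = k * (3 == i)%:R.
  by move=> li; rewrite F3 -(G 3%N i).
have ez z n : (1 < n < 8)%N -> g z f`_n = 1 -> free [:: f0; f1; z].
  move=> /andP[n1 n8] z1; apply/free3P => c3 c4 c5 E.
  have E' i := congr1 (g^~ f`_i) E.
  have c50 : c5 = 0.
    have := E' n; rewrite !(innD ig) !(innZ ig) z1 (inn0 ig) (G 0%N n) // (G 1%N n) //.
    by move: n1; case: (n) => [|[|m]] //= _; lra.
  have := E' 0%N; have := E' 1%N; rewrite c50 scale0r addr0 !(innD ig) !(innZ ig) !(inn0 ig) /=.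
  rewrite (G 0%N 0%N) // (G 1%N 0%N) // (G 0%N 1%N) // (G 1%N 1%N) //=.
  by move=> h1 h0; split=> //; lra.
(* The kernel vectors are, in turn, f2, then f4 corrected by f2, then f6
   corrected by f2 and f4. *)
have k0 : k != 0.
  apply/eqP => z; apply: (ndz f2) => [|i li]; last by rewrite F2 // z mul0r.
  by apply: (ez f2 2%N) => //; rewrite (G 2%N 2%N).
have F24 : F f0 f1 f4 f2 = 0 by rewrite (a4C23 AF) (F2 4%N) // mulr0 oppr0.
have F26 : F f0 f1 f6 f2 = 0 by rewrite (a4C23 AF) (F2 6%N) // mulr0 oppr0.
have z00 z : F f0 f1 z f0 = 0 by exact: a4_03 AF _ _ _.
have z11 z : F f0 f1 z f1 = 0 by exact: a4_13 AF _ _ _.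
have w45 : F f0 f1 f4 f5 != 0.
  apply/eqP => z; pose q := - (F f0 f1 f4 f3 / k) *: f2 + f4.
  apply: (ndz q) => [|i li].
    by apply: (ez q 4%N) => //; rewrite (inn_lin ig) (G 2%N 4%N) // (G 4%N 4%N) //=; ring.
  rewrite (a4lin3 AF) F2 //; move: i li => [|[|[|[|[|[|[|[|//]]]]]]]] _ /=;
    rewrite ?z00 ?z11 ?F24 ?(a4_22 AF) ?z ?F46 ?F47; try ring.
  by field.
have w67 : F f0 f1 f6 f7 != 0.
  apply/eqP => z; pose d := - (F f0 f1 f6 f5 / F f0 f1 f4 f5).
  pose q := - ((d * F f0 f1 f4 f3 + F f0 f1 f6 f3) / k) *: f2 + (d *: f4 + f6).
  have F64 : F f0 f1 f6 f4 = 0 by rewrite (a4C23 AF) F46 oppr0.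
  apply: (ndz q) => [|i li].
    apply: (ez q 6%N) => //; rewrite !(inn_lin ig) (G 2%N 6%N) // (G 4%N 6%N) //.
    rewrite (G 6%N 6%N) //=; ring.
  rewrite !(a4lin3 AF) F2 //; move: i li => [|[|[|[|[|[|[|[|//]]]]]]]] _ /=;
    rewrite ?z00 ?z11 ?F24 ?F26 ?F64 ?(a4_22 AF) ?z ?F46 ?F47; try ring.
    by field.
  by rewrite !mulr0 add0r /d mulNr divfK ?addNr.
by rewrite !mulf_neq0 ?pnatr_eq0.
Qed.

End Metric.
End Curv.

(** * Packaged inner products *)

Section Dot.
Variables (R : realType) (W : lmodType R).

Lemma dot_inner (d : {dot W for idfun}) : inner d.
Proof.
split=> [c x y z|x y|x nx]; first by rewrite linearPl.
  by rewrite [LHS]hermC expr0 mul1r.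
exact: neq0_dnorm_gt0.
Qed.

Lemma inner_dot (g : W -> W -> R) : inner g ->
  exists d : {dot W for idfun}, forall x y, d x y = g x y.
Proof.
move=> ig.
have gl z : GRing.linear_for *%R (g^~ z) by move=> c x y; exact: inn_lin ig _ _ _ _.
have gr z : GRing.linear_for (idfun \; *%R) (g z).
  by move=> c x y; rewrite /= (innDr ig) (innZr ig).
have gs x y : g x y = (-1) ^+ false * idfun (g y x) by rewrite mul1r (inn_sym ig).
pose b := isBilinear.Build R W W R *%R (idfun \; *%R) g
    (fun u' => zmod_morphism_linear (gl u'))
    (fun u => zmod_morphism_linear (gr u))
    (fun u' => scalable_linear (gl u'))
    (fun u => scalable_linear (gr u)).
pose h := isHermitianSesquilinear.Build R W false idfun g gs.
pose p := isDotProduct.Build R W g (inn_pos ig).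
pose d : {dot W for idfun} := HB.pack g b h p.
by exists d.
Qed.

End Dot.

(** * From constant curvature to condition (C) *)

Section Forward.
Variables (R : realType) (W : vectType R).
Hypothesis dimW : \dim {: W} = 8%N.
Variable Phi : 4.-tuple W -> R.
Hypothesis Phi_form : alternating_form Phi.
Let F x y z w := Phi [tuple x; y; z; w].
Let AF : alt4form F := alt4form_of Phi_form.
Implicit Types (u v w x y z : W).

(** The squared length of the bivector u ^ v. *)
Definition gram2 (g : W -> W -> R) u v := g u u * g v v - g u v ^+ 2.

Lemma curvature_polar (g : W -> W -> R) k e : inner g ->
  (forall u v, theta Phi u v u v e = k * gram2 g u v) ->
  forall u v w, theta Phi u v u w e = k * (g u u * g v w - g u v * g u w).
Proof.
move=> ig K; apply: (bi_polar (theta_biform Phi_form e) (P := fun u v w => k * (g u u * g v w - g u v * g u w))).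
- by move=> u c v v' w; rewrite (inn_lin ig) (innDr ig) (innZr ig); ring.
- by move=> u v w; rewrite (inn_sym ig w v); ring.
- by move=> u v; rewrite K /gram2; ring.
Qed.

Section Metric.
Variable (g : W -> W -> R).
Hypothesis ig : inner g.

Lemma gram2_gt0 u v : free [:: u; v] -> 0 < gram2 g u v.
Proof.
move=> fr.
have [f0 [f1 [f2 [a [b [c [_ [_ [_ [on3 uE vE _]]]]]]]]]] := gram_schmidt3 dimW ig u v 0.
have [a0 c0] : a != 0 /\ c != 0 by apply: (@triangular_free _ _ a b c f0 f1); rewrite -uE -vE.
rewrite /gram2 uE vE !(innZ ig, innZr ig, innD ig, innDr ig).
rewrite (on3 0%N 0%N) // (on3 1%N 1%N) // (on3 0%N 1%N) // (on3 1%N 0%N) //=.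
rewrite (_ : _ - _ = (a * c) ^+ 2); first by rewrite exprn_even_gt0 //= mulf_neq0.
ring.
Qed.

(** A linear system for g v w and g u w whose determinant is gram2 g u v. *)
Lemma polar_perp u v w : free [:: u; v] ->
  g u u * g v w - g u v * g u w = 0 -> g v v * g u w - g v u * g v w = 0 ->
  g v w = 0 /\ g u w = 0.
Proof.
move=> fuv h1 h2; rewrite (inn_sym ig u v) in h2.
have gp := gram2_gt0 fuv; rewrite /gram2 expr2 in gp.
split.
  suff /eqP : (g u u * g v v - g u v * g u v) * g v w = 0.
    by rewrite mulf_eq0 (gt_eqF gp) => /eqP.
  have -> : (g u u * g v v - g u v * g u v) * g v w =
    g v v * (g u u * g v w - g u v * g u w) + g u v * (g v v * g u w - g u v * g v w) by ring.
  by rewrite h1 h2; ring.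
suff /eqP : (g u u * g v v - g u v * g u v) * g u w = 0.
  by rewrite mulf_eq0 (gt_eqF gp) => /eqP.
have -> : (g u u * g v v - g u v * g u v) * g u w =
  g u u * (g v v * g u w - g u v * g v w) + g u v * (g u u * g v w - g u v * g u w) by ring.
by rewrite h1 h2; ring.
Qed.

Variable e : 8.-tuple W.
Hypothesis one : orthonormal_seq g e.

(** For this curvature, the hypotheses of (C) mean that w is orthogonal to u
    and v, and then each side of the equivalence means that x is orthogonal to w.
    *)
Lemma curvature_condC k : k != 0 ->
  (forall u v, theta Phi u v u v e = k * gram2 g u v) ->
  nondegenerate_form Phi -> condition_C Phi.
Proof.
move=> k0 K nd; split=> // u v w fr.
have P := curvature_polar ig K.
have T0 a b c d := theta_zero dimW ig Phi_form a b c d one.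
rewrite -[wedge _ _]/(theta Phi u v u w) -[X in _ -> X -> _]/(theta Phi v u v w =1 (fun=> 0)).
move=> /T0 + /T0 +; rewrite !P => /eqP + /eqP; rewrite !mulf_eq0 !(negbTE k0) /= => /eqP h1 /eqP h2 x.
rewrite -[X in X <-> _]/(theta Phi u w u x =1 (fun=> 0)).
rewrite -[X in _ <-> X]/(theta Phi v w v x =1 (fun=> 0)).
have fuv : free [:: u; v] by apply: free3_12 fr.
have gp := gram2_gt0 fuv; rewrite /gram2 in gp.
have [vw0 uw0] := polar_perp fuv h1 h2.
have u0 : g u u != 0 by apply/eqP => z; move: gp; rewrite z mul0r; have := sqr_ge0 (g u v); lra.
have v0 : g v v != 0 by apply/eqP => z; move: gp; rewrite z mulr0; have := sqr_ge0 (g u v); lra.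
rewrite -!T0 !P uw0 vw0 !mul0r !subr0; split=> /eqP;
  rewrite !mulf_eq0 (negbTE k0) ?(negbTE u0) ?(negbTE v0) /= => /eqP ->; ring.
Qed.

End Metric.
End Forward.

(** * The curvature of a compatible 4-form *)

Section Compatible.
Variables (R : realType) (W : vectType R).
Hypothesis dimW : \dim {: W} = 8%N.
Variable Phi : 4.-tuple W -> R.
Hypothesis Phi_form : alternating_form Phi.
Let F x y z w := Phi [tuple x; y; z; w].
Let AF : alt4form F := alt4form_of Phi_form.
Implicit Types (u v w x y z : W).

(** Compatibility in terms of the unit covector Phi(u, v, w, .) of an
    orthonormal triple; the sign lost by moving the free slot from the front to
    the end does not affect its length. *)
Definition unit_triple_product (g : W -> W -> R) := forall u v w, orthonormal_seq g [:: u; v; w] ->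
  exists y, (forall x, F u v w x = g y x) /\ g y y = 1.

Lemma compatible_cross (d : {dot W for idfun}) : compatible d Phi -> unit_triple_product d.
Proof.
move=> [m [mE [_ mx]]] u v w on; have id := dot_inner d.
exists (-1 *: m [tuple u; v; w]); split=> [x|].
  rewrite (innZ id) (inn_sym id) mE -/(F x u v w) mulN1r.
  by rewrite -[RHS]opprK -(a4C01 AF) -(a4C12 AF) -(a4C23 AF); rewrite /F.
rewrite (innZ id) (innZr id) mulrA mulrNN mulr1 mul1r.
have [_ _ _ nE] := mx u v w; move: nE; rewrite /norm /norm_wedge.
rewrite (_ : \matrix_(_, _) _ = 1%:M); last first.
  apply/matrixP => i j; rewrite !mxE !(tnth_nth 0) (on i j) ?ltn_ord //.
rewrite det1 sqrtr1 => E.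
by rewrite -[LHS]sqr_sqrtr ?(inn_ge0 id) // E expr1n.
Qed.

(** An alternating form sees only the diagonal of a triangular change of
    vectors. *)
Lemma a4_triangular a b c d k l f0 f1 f2 y :
  F (a *: f0) (b *: f0 + c *: f1) (d *: f0 + (k *: f1 + l *: f2)) y =
  a * c * l * F f0 f1 f2 y.
Proof.
rewrite (a4Z AF) (a4lin2 AF) (a4_00 AF) (a4Z2 AF) !(a4lin3 AF) (a4Z3 AF).
by rewrite (a4_02 AF) (a4_11 AF); ring.
Qed.

Section Metric.
Variable (g : W -> W -> R).
Hypothesis ig : inner g.
Hypothesis cg : unit_triple_product g.

Lemma orthonormal_seq3 (f : seq W) i j k : orthonormal_seq g f -> (i < size f)%N -> (j < size f)%N ->
  (k < size f)%N -> i != j -> i != k -> j != k -> orthonormal_seq g [:: f`_i; f`_j; f`_k].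
Proof.
move=> on li lj lk ij ik jk.
have [ji ki kj] : [/\ j != i, k != i & k != j] by rewrite !(eq_sym _ i) (eq_sym k).
by move=> [|[|[|//]]] [|[|[|//]]] _ _ /=; rewrite on // ?eqxx ?(negbTE ij) ?(negbTE ik) ?(negbTE jk) ?(negbTE ji) ?(negbTE ki)
  ?(negbTE kj).
Qed.

Lemma cross_nondegenerate : nondegenerate_form Phi.
Proof.
move=> u v w fr.
have [f0 [f1 [f2 [a [b [c [d [k [l [on3 uE vE wE]]]]]]]]]] := gram_schmidt3 dimW ig u v w.
have [y [yE y1]] := cg on3; exists y; rewrite -/(F u v w y).
have [a0 c0] : a != 0 /\ c != 0.
  by apply: (@triangular_free _ _ a b c f0 f1); rewrite -uE -vE; exact: free3_12 fr.
have l0 : l != 0.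
  apply/eqP => z; move/free3P: fr; rewrite uE vE wE z scale0r addr0 => K.
  have [|_ _ /eqP] := K (b * k - c * d) (- (a * k)) (a * c); last first.
    by rewrite mulf_eq0 (negbTE a0) (negbTE c0).
  rewrite !scalerDr !scalerA [X in X + _ = 0]addrA addrACA -!scalerDl.
  rewrite (_ : _ * a + _ + _ = 0); last by ring.
  by rewrite (_ : _ + _ = 0 :> R) ?scale0r ?addr0 //; ring.
by rewrite uE vE wE a4_triangular yE y1 mulr1 !mulf_neq0.
Qed.

Variable e : 8.-tuple W.
Hypothesis one : orthonormal_seq g e.

Lemma cross_norm u v w f : orthonormal_seq g [:: u; v; w] -> orthonormal_seq g f -> size f = 8%N ->
  \sum_(i < 8) F u v w f`_i ^+ 2 = 1.
Proof.
move=> on onf sf; have [y [yE <-]] := cg on.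
rewrite [RHS](onb_parseval ig dimW y y onf sf); apply: eq_bigr => i _.
by rewrite yE expr2.
Qed.

(** The skew matrix of Phi(f0, f1, ., .) has unit rows. In an adapted basis
    the row of f2 is concentrated in the entry f3, so by skewness the row of f3 is
    concentrated in the entry f2, and so on: the matrix consists of three blocks
    with entries +1 and -1, and its Pfaffian is a sign. *)
Lemma cross_theta_on f0 f1 : orthonormal_seq g [:: f0; f1] -> theta Phi f0 f1 f0 f1 e ^+ 2 = 36.
Proof.
move=> on2.
have [//||f2 [_ [on3 _ _]]] := orthonormal_seq_ext ig dimW (y := 0) on2; first by move=> i; rewrite (inn0 ig).
have [f3 [f4 [f5 [f6 [f7 [k [s [[on8 F3 F46 F47] s2 ->]]]]]]]] := theta_adapted dimW Phi_form ig one on3.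
rewrite -/(F f0 f1 f4 f5) -/(F f0 f1 f6 f7).
rewrite -/(F f0 f1 f4 f6) in F46; rewrite -/(F f0 f1 f4 f7) in F47.
pose f := [:: f0; f1; f2; f3; f4; f5; f6; f7].
have on i : (1 < i < 8)%N -> orthonormal_seq g [:: f0; f1; f`_i].
  move=> /andP[i1 i8]; apply: (@orthonormal_seq3 f 0%N 1%N i on8) => //.
    by rewrite eq_sym -lt0n; apply: leq_trans i1.
  by rewrite neq_ltn i1.
have N i : (1 < i < 8)%N -> F f0 f1 f`_i f2 ^+ 2 + (F f0 f1 f`_i f3 ^+ 2 +
  (F f0 f1 f`_i f4 ^+ 2 + (F f0 f1 f`_i f5 ^+ 2 + (F f0 f1 f`_i f6 ^+ 2 + F f0 f1 f`_i f7 ^+ 2)))) = 1.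
  move=> li; rewrite -(cross_norm (on i li) on8 erefl) !big_ord_recl big_ord0 /=.
  by rewrite (a4_03 AF) (a4_13 AF); ring.
have A x y : F f0 f1 y x = - F f0 f1 x y by exact: a4C23.
have Z x : F f0 f1 x x = 0 by exact: a4_22.
have G i := on8 3%N i.
have F2i i : (i < 8)%N -> F f0 f1 f2 f`_i = k * (3 == i)%:R by move=> li; rewrite /F F3 -G.
have E24 : F f0 f1 f2 f4 = 0 by rewrite (F2i 4%N) // mulr0.
have E25 : F f0 f1 f2 f5 = 0 by rewrite (F2i 5%N) // mulr0.
have E26 : F f0 f1 f2 f6 = 0 by rewrite (F2i 6%N) // mulr0.
have E27 : F f0 f1 f2 f7 = 0 by rewrite (F2i 7%N) // mulr0.
have E23 : F f0 f1 f2 f3 = k by rewrite (F2i 3%N) // mulr1.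
have k2 : k ^+ 2 = 1 by have := N 2%N isT; rewrite /= Z E24 E25 E26 E27 E23 => <-; ring.
have sq (a : R) : a ^+ 2 = 0 -> a = 0 by move=> /eqP; rewrite sqrf_eq0 => /eqP.
have := N 3%N isT; rewrite /= Z (A f2) E23 sqrrN k2 => N3.
have p x := sqr_ge0 (F f0 f1 f3 x).
have E34 : F f0 f1 f3 f4 = 0 by apply: sq; move: (p f4) (p f5) (p f6) (p f7); lra.
have E35 : F f0 f1 f3 f5 = 0 by apply: sq; move: (p f4) (p f5) (p f6) (p f7); lra.
have E36 : F f0 f1 f3 f6 = 0 by apply: sq; move: (p f4) (p f5) (p f6) (p f7); lra.
have E37 : F f0 f1 f3 f7 = 0 by apply: sq; move: (p f4) (p f5) (p f6) (p f7); lra.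
have c2 : F f0 f1 f4 f5 ^+ 2 = 1.
  have := N 4%N isT; rewrite /= Z (A f2) (A f3) E24 E34 F46 F47 => <-; ring.
have := N 5%N isT; rewrite /= Z (A f2) (A f3) (A f4) E25 E35 !sqrrN c2 => N5.
have q x := sqr_ge0 (F f0 f1 f5 x).
have E56 : F f0 f1 f5 f6 = 0 by apply: sq; move: (q f6) (q f7); lra.
have d2 : F f0 f1 f6 f7 ^+ 2 = 1.
  have := N 6%N isT; rewrite /= Z (A f2) (A f3) (A f4) (A f5) E26 E36 F46 E56 => <-; ring.
by rewrite !exprMn s2 k2 c2 d2; ring.
Qed.

(** The curvature of an orthonormal pair is 6 or -6, and definiteness makes
    the sign the same for all pairs. *)
Lemma cross_curvature : exists2 k, k ^+ 2 = 36 &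
  forall u v, theta Phi u v u v e = k * gram2 g u v.
Proof.
have bt := theta_biform Phi_form e.
have [|s [s2 pos]] := biform_definite bt.
  by move=> u v fr; exact: (nondegenerate_theta dimW Phi_form ig one cross_nondegenerate fr).
have s0 : s != 0 by rewrite -sqrf_eq0 s2 oner_eq0.
exists (s * 6); first by rewrite exprMn s2; ring.
move=> u v.
have [f0 [f1 [f2 [a [b [c [_ [_ [_ [on3 -> -> _]]]]]]]]]] := gram_schmidt3 dimW ig u v 0.
have on2 : orthonormal_seq g [:: f0; f1].
  move=> i j li lj; have := on3 i j (ltnW li) (ltnW lj).
  by move: i j li lj => [|[|//]] [|[|//]].
rewrite (bi_triangular bt) /gram2 !(innZ ig, innZr ig, innD ig, innDr ig).
rewrite (on2 0%N 0%N) // (on2 1%N 1%N) // (on2 0%N 1%N) // (on2 1%N 0%N) //=.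
have -> : theta Phi f0 f1 f0 f1 e = s * 6; last by ring.
have := cross_theta_on on2; have := pos _ _ (orthonormal_seq_free ig on2).
move: (theta _ _ _ _ _ _) => t t0 t2.
have /eqP : (s * t - 6) * (s * t + 6) = 0.
  have -> : (s * t - 6) * (s * t + 6) = s ^+ 2 * t ^+ 2 - 36 by ring.
  by rewrite s2 t2; ring.
rewrite mulf_eq0 => /orP[/eqP h|/eqP h]; last by move: t0; lra.
have -> : t = s * (s * t) by rewrite mulrA -expr2 s2 mul1r.
by congr (_ * _); lra.
Qed.

End Metric.
End Compatible.

(** * Uniqueness of the compatible inner product *)

Section Unique.
Variables (R : realType) (W : vectType R).
Hypothesis dimW : \dim {: W} = 8%N.
Implicit Types (u v w x y z : W).

(** A basis that is orthonormal for g1 is orthogonal for g2 by polar_perp, and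
    the products of the squared g2-lengths of any two of its vectors agree; with
    at least three vectors, so do the lengths. *)
Lemma gram2_proportional (g1 g2 : W -> W -> R) (k1 k2 : R) :
  inner g1 -> inner g2 -> k2 != 0 ->
  (forall u v, k1 * gram2 g1 u v = k2 * gram2 g2 u v) ->
  exists2 m, 0 < m & forall u v, g2 u v = m * g1 u v.
Proof.
move=> i1 i2 k0 E.
have [e one] := exists_onb dimW i1.
have on i j : (i < 8)%N -> (j < 8)%N -> g1 e`_i e`_j = (i == j)%:R.
  by move=> li lj; apply: one; rewrite size_tuple.
have P u v w : k1 * (g1 u u * g1 v w - g1 u v * g1 u w) =
               k2 * (g2 u u * g2 v w - g2 u v * g2 u w).
  have := E u (1 *: v + w); have := E u v; have := E u w; rewrite /gram2.
  rewrite !(inn_lin i1) !(inn_lin i2) !(inn_sym i1 (1 *: v + w)) !(inn_sym i2 (1 *: v + w)).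
  rewrite !(inn_lin i1) !(inn_lin i2) !(inn_sym i1 u) !(inn_sym i2 u).
  rewrite (inn_sym i1 v w) (inn_sym i2 v w); lra.
have fr i j : (i < 8)%N -> (j < 8)%N -> i != j -> free [:: e`_i; e`_j].
  move=> li lj nij; apply: (orthonormal_seq_free i1) => -[|[|//]] [|[|//]] _ _ /=;
  by rewrite on // ?eqxx // ?(negbTE nij) // eq_sym (negbTE nij).
have third i j : (i < 8)%N -> (j < 8)%N -> exists l, [/\ (l < 8)%N, l != i & l != j].
  have [|i0] := boolP ((i != 0%N) && (j != 0%N)).
    by move/andP=> [] ? ? _ _; exists 0%N; rewrite !(eq_sym 0%N).
  have [|i1'] := boolP ((i != 1%N) && (j != 1%N)).
    by move/andP=> [] ? ? _ _; exists 1%N; rewrite !(eq_sym 1%N).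
  exists 2%N; split=> //; apply/eqP => z; move: i0 i1'; rewrite -z /=.
    by case: (j) => [|[]].
  by case: (i) => [|[]].
have off i j : (i < 8)%N -> (j < 8)%N -> i != j -> g2 e`_i e`_j = 0.
  move=> li lj nij; have [l [ll nli nlj]] := third i j li lj.
  have S u v w : g1 u v = 0 -> g1 u w = 0 -> g1 v w = 0 ->
     g2 u u * g2 v w - g2 u v * g2 u w = 0.
    move=> a b c; apply: (mulfI k0); rewrite -P a b c; ring.
  have z a b : (a < 8)%N -> (b < 8)%N -> a != b -> g1 e`_a e`_b = 0.
    by move=> la lb nab; rewrite on // (negbTE nab).
  have [] := polar_perp dimW i2 (w := e`_j) (fr l i ll li nli); last by [].
    by apply: S; apply: z.
  by apply: S; apply: z => //; rewrite eq_sym.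
have diag i j : (i < 8)%N -> (j < 8)%N -> i != j ->
    k1 = k2 * (g2 e`_i e`_i * g2 e`_j e`_j).
  move=> li lj nij; have := E e`_i e`_j.
  by rewrite /gram2 !on // !eqxx (negbTE nij) (off i j) //= => h; lra.
have pos i : (i < 8)%N -> 0 < g2 e`_i e`_i.
  move=> li; apply: (inn_pos i2); apply/eqP => z; have := on i i li li.
  by rewrite z (inn0 i1) eqxx => /eqP; rewrite eq_sym oner_eq0.
have same i j : (i < 8)%N -> (j < 8)%N -> g2 e`_i e`_i = g2 e`_j e`_j.
  move=> li lj; have [->//|nij] := eqVneq i j.
  have [l [ll nli nlj]] := third i j li lj.
  have := diag l i ll li nli; rewrite (diag l j ll lj nlj) => /(mulfI k0).
  by move/(mulfI (lt0r_neq0 (pos l ll))).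
exists (g2 e`_0 e`_0) => [|u v]; first exact: pos.
rewrite (onb_parseval i1 dimW u v one (size_tuple e)) big_distrr.
rewrite {1}(onb_expand i1 dimW u one (size_tuple e)) (inn_suml i2).
apply: eq_bigr => i _; rewrite (innZ i2).
rewrite {1}(onb_expand i1 dimW v one (size_tuple e)) (inn_sumr i2) (bigD1 i) //=.
rewrite big1 ?addr0 => [|j nj]; rewrite (innZr i2).
  by rewrite (same i 0%N) //; ring.
by rewrite off ?mulr0 // eq_sym.
Qed.

Variable Phi : 4.-tuple W -> R.
Hypothesis Phi_form : alternating_form Phi.
Let F x y z w := Phi [tuple x; y; z; w].
Let AF : alt4form F := alt4form_of Phi_form.

(** The curvatures agree up to a constant, hence g2 = r^2 g1. Rescaling a
    g1-orthonormal triple by 1 / r makes it g2-orthonormal, and the two unit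
    covectors that it defines are related by r^-5; comparing their lengths gives
    r^8 = 1. *)
Lemma cross_unique (g1 g2 : W -> W -> R) : inner g1 -> inner g2 ->
  unit_triple_product Phi g1 -> unit_triple_product Phi g2 -> forall u v, g1 u v = g2 u v.
Proof.
move=> i1 i2 c1 c2.
have [e1 one1] := exists_onb dimW i1; have [e2 one2] := exists_onb dimW i2.
have [k1 k1E K1] := cross_curvature dimW Phi_form i1 c1 one1.
have [k2 k2E K2] := cross_curvature dimW Phi_form i2 c2 one2.
have [c [cE _]] := theta_basis dimW i1 Phi_form e2 one1.
have k20 : k2 != 0 by rewrite -sqrf_eq0 k2E pnatr_eq0.
have [|m m0 mE] := gram2_proportional (k1 := c * k1) i1 i2 k20.
  by move=> u v; rewrite -K2 cE K1 mulrA.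
have [r r0 rE] : exists2 r, 0 < r & m = r ^+ 2.
  by exists (Num.sqrt m); rewrite ?sqrtr_gt0 // sqr_sqrtr // ltW.
have rn0 := lt0r_neq0 r0.
pose f i := e1`_i.
have on i j : (i < 8)%N -> (j < 8)%N -> g1 e1`_i e1`_j = (i == j)%:R.
  by move=> li lj; apply: one1; rewrite size_tuple.
have [|y [yE y1]] := c1 (f 0%N) (f 1%N) (f 2%N).
  by move=> [|[|[|//]]] [|[|[|//]]] _ _ /=; rewrite on.
have [|z [zE z1]] := c2 (r^-1 *: f 0%N) (r^-1 *: f 1%N) (r^-1 *: f 2%N).
  by move=> [|[|[|//]]] [|[|[|//]]] _ _ /=; rewrite (innZ i2) (innZr i2) mE on //= rE; field.
have zy : z = (r ^- 5) *: y.
  apply: (inn_inj i2) => x; rewrite -zE -/(F _ _ _ _) (a4Z AF) (a4Z2 AF) (a4Z3 AF).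
  by rewrite (innZ i2) mE rE -yE /F; field.
have r8 : r = 1.
  apply/eqP; rewrite -(pexpr_eq1 (n := 8)) ?ltW //; apply/eqP.
  apply: invr_inj; rewrite invr1; move: z1; rewrite zy (innZ i2) (innZr i2) mE rE y1 => <-.
  by field.
by move=> u v; rewrite mE rE r8; ring.
Qed.

End Unique.

(** * The comass is attained *)

Section Max.
Variables (R : realType) (W : vectType R).
Hypothesis dimW : \dim {: W} = 8%N.
Variable (g : W -> W -> R).
Hypothesis ig : inner g.
Variable F : W -> W -> W -> W -> R.
Hypothesis AF : alt4form F.
Implicit Types (u v w x : W).

(** In coordinates, the quadruples of unit vectors form a compact set and F is
    a polynomial. *)
Lemma max_unit : exists h1 h2 h3 h4 : W,
  [/\ g h1 h1 = 1, g h2 h2 = 1, g h3 h3 = 1 & g h4 h4 = 1] /\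
  forall u v w x, g u u = 1 -> g v v = 1 -> g w w = 1 -> g x x = 1 ->
  F u v w x <= F h1 h2 h3 h4.
Proof.
have [|//|b [sb onb]] := @orthonormal_seq_extend _ _ g ig dimW [::] 8; first by [].
pose T := 'rV[R]_(4 * 8).
pose co (k : 'I_4) (j : 'I_8) (c : T) : R := c ord0 (mxvec_index k j).
pose V k c := \sum_(j < 8) co k j c *: b`_j.
have co_cont k j : continuous (co k j) by exact: coord_continuous.
have gV k c : g (V k c) (V k c) = \sum_(j < 8) co k j c ^+ 2.
  rewrite (inn_suml ig); apply: eq_bigr => i _; rewrite (innZ ig) (inn_sumr ig).
  rewrite (bigD1 i) //= (innZr ig) onb ?sb // eqxx mulr1 big1 ?addr0 // => j nj.
  by rewrite (innZr ig) onb ?sb // (inj_eq val_inj) eq_sym (negbTE nj) mulr0.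
have VE (t : 'I_4 -> W) : exists c, forall k, V k c = t k.
  exists (mxvec (\matrix_(k < 4, j < 8) g (t k) b`_j)) => k.
  rewrite [RHS](onb_expand ig dimW _ onb sb); apply: eq_bigr => j _.
  by rewrite /co mxvecE mxE.
have sumc (f : 'I_8 -> T -> R) k : (forall j, continuous (f j)) ->
    continuous (fun c => \sum_(j < 8) co k j c * f j c).
  move=> fc; apply: continuous_big => [x|j _ c]; first exact: add_continuous.
  by apply: continuousM; [exact: co_cont|exact: fc].
have lin_sum (l : W -> R) k c : (forall a x y, l (a *: x + y) = a * l x + l y) ->
    l (V k c) = \sum_(j < 8) co k j c * l b`_j.
  move=> ll; have l0 : l 0 = 0 by have := ll 1 0 0; rewrite scaler0 addr0; lra.
  have lD x y : l (x + y) = l x + l y by rewrite -[x]scale1r ll mul1r scale1r.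
  rewrite (big_morph l lD l0); apply: eq_bigr => i _.
  by rewrite -[_ *: _]addr0 ll l0 addr0.
pose f c := F (V (inord 0) c) (V (inord 1) c) (V (inord 2) c) (V (inord 3) c).
have f_cont : continuous f.
  have -> : f = fun c => \sum_(j < 8) co (inord 0) j c * (\sum_(j1 < 8) co (inord 1) j1 c *
      (\sum_(j2 < 8) co (inord 2) j2 c * (\sum_(j3 < 8) co (inord 3) j3 c * F b`_j b`_j1 b`_j2 b`_j3))).
    apply: funext => c; rewrite /f.
    rewrite (lin_sum (fun x => F x _ _ _)) => [|*]; last exact: a4lin.
    apply: eq_bigr => j _; congr (_ * _).
    rewrite (lin_sum (fun x => F _ x _ _)) => [|*]; last exact: a4lin2.
    apply: eq_bigr => j1 _; congr (_ * _).
    rewrite (lin_sum (fun x => F _ _ x _)) => [|*]; last exact: a4lin3.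
    apply: eq_bigr => j2 _; congr (_ * _).
    by rewrite (lin_sum (fun x => F _ _ _ x)) => [|*]; last exact: a4lin4.
  apply: (sumc) => j; apply: (sumc) => j1; apply: (sumc) => j2; apply: (sumc) => j3.
  by move=> c; apply: cst_continuous.
pose S : set T := (\bigcap_(k in [set: 'I_4])
   (fun c => \sum_(j < 8) co k j c * co k j c) @^-1` [set x : R | x = 1])%classic.
have SE c : S c <-> forall k, g (V k c) (V k c) = 1.
  split=> [Sc k|H k _]; first by rewrite gV; apply: Sc.
  by have := H k; rewrite gV.
have S_closed : closed S.
  apply: closed_bigI => k _; apply: (proj1 (continuous_closedP _)); last exact: closed_eq.
  by apply: (sumc) => j; exact: co_cont.
have S_compact : compact S.
  apply: (subclosed_compact S_closed (B := [set v : T | forall i, (`[(-1), 1]%classic) (v ord0 i)])%classic).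
    by apply: (@rV_compact R _ (fun=> `[(-1), 1]%classic)) => i; exact: segment_compact.
  move=> c /SE Sc i; case/mxvec_indexP: i => k j.
  rewrite /= in_itv /= -ler_norml -(@ler_pXn2r _ 2) ?nnegrE // expr1n real_normK ?num_real //.
  rewrite -(Sc k) gV (bigD1 j) //= lerDl sumr_ge0 // => l _; exact: sqr_ge0.
have [|c cS cmax] := compact_EVT_max (f := f) _ S_compact (continuous_subspaceT f_cont).
  have [c cE] := VE (fun=> b`_0); exists c; apply/SE => k.
  by rewrite cE onb ?sb.
move: cS; rewrite inE => /SE cS.
exists (V (inord 0) c), (V (inord 1) c), (V (inord 2) c), (V (inord 3) c).
split=> // u v w x u1 v1 w1 x1.
have [d dE] := VE (fun k : 'I_4 => nth 0 [:: u; v; w; x] k).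
have : f d <= f c.
  apply: cmax; rewrite inE; apply/SE => k; rewrite dE.
  by case: k => -[|[|[|[|]]]].
by rewrite /f !dE !inordK.
Qed.

End Max.

(** * Quaternionic triples of 2-forms in dimension four *)

Section Skew4.
Variable R : realType.

(** The skew matrix with first row p; the remaining entries n are arranged so
    that exchanging p and n is the Hodge star on 2-forms, and p . n is the
    Pfaffian. *)
Definition skew4 (p1 p2 p3 n1 n2 n3 : R) : 'M[R]_4 := \matrix_(i < 4, j < 4)
  nth 0 (nth [::] [:: [:: 0; p1; p2; p3]; [:: - p1; 0; n3; - n2];
                      [:: - p2; - n3; 0; n1]; [:: - p3; n2; - n1; 0]] i) j.

Ltac entries :=
  apply/matrixP; move=> [[|[|[|[|//]]]] ?]; move=> [[|[|[|[|//]]]] ?];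
  rewrite !mxE ?big_ord_recl ?big_ord0 ?mxE /= ?mulr1n ?mulr0n.

(** The polarisation of skew4_starK: the wedge product of two 2-forms, read as
    a matrix identity. *)
Lemma skew4_star p1 p2 p3 n1 n2 n3 q1 q2 q3 m1 m2 m3 :
  skew4 p1 p2 p3 n1 n2 n3 *m skew4 m1 m2 m3 q1 q2 q3 =
  - (p1 * m1 + p2 * m2 + p3 * m3 + n1 * q1 + n2 * q2 + n3 * q3)%:M
  - skew4 q1 q2 q3 m1 m2 m3 *m skew4 n1 n2 n3 p1 p2 p3.
Proof. entries; ring. Qed.

Lemma skew4_starK p1 p2 p3 n1 n2 n3 :
  skew4 p1 p2 p3 n1 n2 n3 *m skew4 n1 n2 n3 p1 p2 p3 =
  - (p1 * n1 + p2 * n2 + p3 * n3)%:M.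
Proof. entries; ring. Qed.

Lemma skew4_tr p1 p2 p3 n1 n2 n3 :
  (skew4 p1 p2 p3 n1 n2 n3)^T = - skew4 p1 p2 p3 n1 n2 n3.
Proof. entries; ring. Qed.

(** For 2-forms M2, M3, M4 on a 4-dimensional space, the product of M2, the
    dual of M3, and M4. If the three forms are orthogonal of equal length under
    the wedge product, it is the symmetric form on vectors that a hyperkaehler
    triple induces. *)
Definition skew4X (p q r m n s : R * R * R) : 'M[R]_4 :=
  let M (p n : R * R * R) := skew4 p.1.1 p.1.2 p.2 n.1.1 n.1.2 n.2 in
  M p m *m M n q *m M r s.

Definition dot3 (p q : R * R * R) := p.1.1 * q.1.1 + p.1.2 * q.1.2 + p.2 * q.2.

(** The wedge relations are quaternion relations up to the scale k. They make
    the product X of skew4X symmetric, so the last two hypotheses say that X is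
    the scalar c. Solving this equation for the third matrix expresses it through
    its own dual, with factor c^2 / k^3; since duality is an involution, the
    square of this factor is 1. *)
Lemma quaternion_scale (p q r m n s : R * R * R) (k c : R) :
  dot3 p m = k -> dot3 q n = k -> dot3 r s = k -> k != 0 ->
  dot3 p n + dot3 q m = 0 -> dot3 p s + dot3 r m = 0 -> dot3 q s + dot3 r n = 0 ->
  (forall i, skew4X p q r m n s i i = c) ->
  (forall i j : 'I_4, (i < j)%N -> skew4X p q r m n s i j + skew4X p q r m n s j i = 0) ->
  k ^+ 6 = c ^+ 4.
Proof.
pose M (p n : R * R * R) := skew4 p.1.1 p.1.2 p.2 n.1.1 n.1.2 n.2.
move=> pm qn rs k0 pq pr qr Xd Xo.
have MS (a b : R * R * R) : M a b *m M b a = - (dot3 a b)%:M by exact: skew4_starK.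
have dotC (a b : R * R * R) : dot3 a b = dot3 b a by rewrite /dot3; ring.
have MC (a b a' b' : R * R * R) : dot3 a b' + dot3 a' b = 0 -> M a b *m M b' a' = - (M a' b' *m M b a).
  move=> h; rewrite /M skew4_star.
  rewrite (_ : _ + _ + _ + _ + _ + _ = dot3 a b' + dot3 a' b); last by rewrite /dot3; ring.
  by rewrite h raddf0 oppr0 sub0r.
pose X := M p m *m M n q *m M r s.
have XE : X = skew4X p q r m n s by [].
have trM a b : (M a b)^T = - M a b by exact: skew4_tr.
have symX : X^T = X.
  have rn : dot3 r n + dot3 q s = 0 by rewrite addrC.
  have sp : dot3 s p + dot3 m r = 0 by rewrite (dotC s) (dotC m).
  have qm : dot3 q m + dot3 p n = 0 by rewrite addrC.
  rewrite /X !trmx_mul !trM !(mulNmx, mulmxN) !opprK mulmxA (MC _ _ _ _ rn).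
  rewrite mulNmx opprK -[LHS]mulmxA. by rewrite (MC _ _ _ _ sp) mulmxN mulmxA (MC _ _ _ _ qm) mulNmx opprK.
have S i j : X j i = X i j.
  by have := congr1 (fun A : 'M_4 => A i j) symX; rewrite [X^T i j]mxE.
have Xc : X = c%:M.
  apply/matrixP => i j; rewrite [RHS]mxE; case: (ltngtP i j) => [ij|ij|/val_inj->].
  - have := Xo i j ij; rewrite -XE S -val_eqE ltn_eqF //= mulr0n; lra.
  - have := Xo j i ij; rewrite -XE S -val_eqE gtn_eqF //= mulr0n; lra.
  - by rewrite eqxx; exact: Xd.
(* X = c multiplied by the dual M s r of M r s on the right, and then by M q n
   *m M m p on the left. *)
have r1 : M p m *m M n q = - (c / k) *: M s r.
  have : X *m M s r = c *: M s r by rewrite Xc mul_scalar_mx.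
  rewrite /X -mulmxA MS rs mulmxN mul_mx_scalar => h.
  by apply: (scalerI k0); rewrite scalerA mulrN (mulrC k) divfK // scaleNr -h opprK.
have r2 : k ^+ 2 *: M r s = - c *: (M p m *m M n q).
  have -> : k ^+ 2 *: M r s = M q n *m M m p *m X.
    have a : M q n *m M m p *m M p m = - k *: M q n.
      by rewrite -mulmxA MS dotC pm mulmxN mul_mx_scalar scaleNr.
    have b : M q n *m M n q = - k%:M by rewrite MS qn.
    rewrite /X !mulmxA a -scalemxAl b scalerN scaleNr opprK -scalemxAl.
    by rewrite mul_scalar_mx scalerA expr2.
  rewrite Xc mul_mx_scalar MC ?scalerN ?scaleNr //; last by rewrite addrC.
have r3 : k ^+ 3 *: M r s = c ^+ 2 *: M s r.
  rewrite exprS -scalerA r2 r1 !scalerA; congr (_ *: _); field.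
  done.
have e3 i j : k ^+ 3 * M r s i j = c ^+ 2 * M s r i j.
  by have := congr1 (fun A : 'M_4 => A i j) r3; rewrite !mxE.
have P i : k ^+ 3 * (nth 0 [:: r.1.1; r.1.2; r.2] i) = c ^+ 2 * nth 0 [:: s.1.1; s.1.2; s.2] i.
  case: i => [|[|[|i]]]; last by rewrite !nth_default ?mulr0.
  - by have := e3 (inord 0) (inord 1); rewrite /M !mxE !inordK.
  - by have := e3 (inord 0) (inord 2); rewrite /M !mxE !inordK.
  - by have := e3 (inord 0) (inord 3); rewrite /M !mxE !inordK.
have N i : k ^+ 3 * (nth 0 [:: s.1.1; s.1.2; s.2] i) = c ^+ 2 * nth 0 [:: r.1.1; r.1.2; r.2] i.
  case: i => [|[|[|i]]]; last by rewrite !nth_default ?mulr0.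
  - by have := e3 (inord 2) (inord 3); rewrite /M !mxE !inordK.
  - by have := e3 (inord 1) (inord 3); rewrite /M !mxE !inordK //= !mulrN => /oppr_inj.
  - by have := e3 (inord 1) (inord 2); rewrite /M !mxE !inordK.
have Z i : (k ^+ 6 - c ^+ 4) * (nth 0 [:: r.1.1; r.1.2; r.2] i) = 0.
  have -> : (k ^+ 6 - c ^+ 4) * (nth 0 [:: r.1.1; r.1.2; r.2] i) =
   k ^+ 3 * (k ^+ 3 * (nth 0 [:: r.1.1; r.1.2; r.2] i)) - c ^+ 2 * (c ^+ 2 * nth 0 [:: r.1.1; r.1.2; r.2] i) by ring.
  by rewrite P -N; ring.
apply/eqP; rewrite -subr_eq0; apply/eqP; apply: (mulIf k0).
rewrite -{2}rs /dot3 mul0r.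
have -> : (k ^+ 6 - c ^+ 4) * (r.1.1 * s.1.1 + r.1.2 * s.1.2 + r.2 * s.2) =
 (k ^+ 6 - c ^+ 4) * r.1.1 * s.1.1 + (k ^+ 6 - c ^+ 4) * r.1.2 * s.1.2 + (k ^+ 6 - c ^+ 4) * r.2 * s.2 by ring.
by rewrite (Z 0%N) (Z 1%N) (Z 2%N); ring.
Qed.

End Skew4.

(** * Permutations and shears of eight vectors *)

Section Alt8.
Variables (R : realType) (W : lmodType R) (f : 8.-tuple W -> R).
Hypothesis Af : alternating_form f.
Variables x1 x2 x3 x4 x5 x6 x7 x8 : W.

Ltac slots i j :=
  apply: (@alternating_swap _ _ _ _ _ _ (@Ordinal 8 i isT) (@Ordinal 8 j isT) Af) => //;
  by case=> -[|[|[|[|[|[|[|[|//]]]]]]]] ?; rewrite // !(tnth_nth 0).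

Ltac shear i j :=
  apply: (@alternating_shear _ _ _ _ _ _ (@Ordinal 8 i isT) (@Ordinal 8 j isT) Af) => //;
  by case=> -[|[|[|[|[|[|[|[|//]]]]]]]] ?; rewrite // !(tnth_nth 0).

Lemma alt8_rot234 :
  f [tuple x1; x3; x4; x2; x5; x6; x7; x8] = f [tuple x1; x2; x3; x4; x5; x6; x7; x8].
Proof.
transitivity (- f [tuple x1; x3; x2; x4; x5; x6; x7; x8]); first by slots 2%N 3%N.
apply/eqP; rewrite eqr_oppLR; apply/eqP; by slots 1%N 2%N.
Qed.

Lemma alt8_rot678 :
  f [tuple x1; x2; x3; x4; x5; x7; x8; x6] = f [tuple x1; x2; x3; x4; x5; x6; x7; x8].
Proof.
transitivity (- f [tuple x1; x2; x3; x4; x5; x7; x6; x8]); first by slots 6%N 7%N.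
apply/eqP; rewrite eqr_oppLR; apply/eqP; by slots 5%N 6%N.
Qed.

Lemma alt8_swap5678 :
  f [tuple x1; x2; x3; x4; x6; x5; x8; x7] = f [tuple x1; x2; x3; x4; x5; x6; x7; x8].
Proof.
transitivity (- f [tuple x1; x2; x3; x4; x6; x5; x7; x8]); first by slots 6%N 7%N.
apply/eqP; rewrite eqr_oppLR; apply/eqP; by slots 4%N 5%N.
Qed.

Lemma alt8_move5 :
  f [tuple x1; x5; x2; x3; x4; x6; x7; x8] = - f [tuple x1; x2; x3; x4; x5; x6; x7; x8].
Proof.
transitivity (- f [tuple x1; x2; x5; x3; x4; x6; x7; x8]); first by slots 1%N 2%N.
congr (- _).
transitivity (- f [tuple x1; x2; x3; x5; x4; x6; x7; x8]); first by slots 2%N 3%N.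
apply/eqP; rewrite eqr_oppLR; apply/eqP; by slots 3%N 4%N.
Qed.

Lemma alt8_shear23 :
  f [tuple x1; x2 + x3; x3; x4; x5; x6; x7; x8] = f [tuple x1; x2; x3; x4; x5; x6; x7; x8].
Proof. by shear 1%N 2%N. Qed.

Lemma alt8_shear26 :
  f [tuple x1; x2 + x6; x3; x4; x5; x6; x7; x8] = f [tuple x1; x2; x3; x4; x5; x6; x7; x8].
Proof. by shear 1%N 5%N. Qed.

End Alt8.

Lemma orthonormal_seq_map (R : realType) (W : vectType R) (g : W -> W -> R) (s : seq W) (idx : seq nat) :
  orthonormal_seq g s -> uniq idx -> all (fun i => (i < size s)%N) idx ->
  orthonormal_seq g [seq s`_i | i <- idx].
Proof.
move=> on ui /allP al i j; rewrite size_map => li lj.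
by rewrite !(nth_map 0%N) // on ?al ?mem_nth // nth_uniq.
Qed.

(** * The comass of a 4-form of constant curvature *)

Section Frame.
Variables (R : realType) (W : vectType R).
Variable (g : W -> W -> R).
Hypothesis ig : inner g.
Variable Phi : 4.-tuple W -> R.
Hypothesis Phi_form : alternating_form Phi.
Let F x y z w := Phi [tuple x; y; z; w].
Let AF : alt4form F := alt4form_of Phi_form.

(** The three equations are the first-order conditions for F to have its
    maximum a over unit vectors at h1, h2, h3, h4; in particular F vanishes on h1,
    two of the vectors h2, h3, h4, and one of h5, ..., h8. *)
Definition frame (a k : R) (h1 h2 h3 h4 h5 h6 h7 h8 : W) :=
  [/\ orthonormal_seq g [:: h1; h2; h3; h4; h5; h6; h7; h8],
      forall y, F h1 h2 h3 y = a * g h4 y,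
      forall y, F h1 h2 h4 y = - a * g h3 y,
      forall y, F h1 h3 h4 y = a * g h2 y &
      forall u v, theta Phi u v u v [tuple h1; h2; h3; h4; h5; h6; h7; h8] = k * gram2 g u v].

Variables (a k : R).

Lemma frame_rot234 h1 h2 h3 h4 h5 h6 h7 h8 : frame a k h1 h2 h3 h4 h5 h6 h7 h8 ->
  frame a k h1 h3 h4 h2 h5 h6 h7 h8.
Proof.
move=> [on c1 c2 c3 th]; split=> [|//|y|y|u v].
- exact: (orthonormal_seq_map (idx := [:: 0; 2; 3; 1; 4; 5; 6; 7]%N) on).
- by rewrite (a4C12 AF) c1 mulNr.
- by rewrite (a4C12 AF) c2 mulNr opprK.
- by rewrite alt8_rot234 //; exact: theta_alternating.
Qed.

Lemma frame_rot678 h1 h2 h3 h4 h5 h6 h7 h8 : frame a k h1 h2 h3 h4 h5 h6 h7 h8 ->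
  frame a k h1 h2 h3 h4 h5 h7 h8 h6.
Proof.
move=> [on c1 c2 c3 th]; split=> // [|u v].
- exact: (orthonormal_seq_map (idx := [:: 0; 1; 2; 3; 4; 6; 7; 5]%N) on).
- by rewrite alt8_rot678 //; exact: theta_alternating.
Qed.

Lemma frame_swap5678 h1 h2 h3 h4 h5 h6 h7 h8 : frame a k h1 h2 h3 h4 h5 h6 h7 h8 ->
  frame a k h1 h2 h3 h4 h6 h5 h8 h7.
Proof.
move=> [on c1 c2 c3 th]; split=> // [|u v].
- exact: (orthonormal_seq_map (idx := [:: 0; 1; 2; 3; 5; 4; 7; 6]%N) on).
- by rewrite alt8_swap5678 //; exact: theta_alternating.
Qed.

Let th_pf u v x1 x2 x3 x4 x5 x6 : theta Phi u v u v [tuple u; v; x1; x2; x3; x4; x5; x6] =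
  6 * pf6 (F u v) x1 x2 x3 x4 x5 x6.
Proof. exact: theta_pf. Qed.

(** The curvature of h1, h2, whose Pfaffian splits off the entry F h1 h2 h3 h4
    = a. *)
Lemma frame_pf h1 h2 h3 h4 h5 h6 h7 h8 : frame a k h1 h2 h3 h4 h5 h6 h7 h8 ->
  a * pf4 (F h1 h2) h5 h6 h7 h8 = k / 6.
Proof.
move=> [on c1 c2 c3 th]; have := th h1 h2; rewrite th_pf /gram2.
have G i j := on i j; have G3 i := on 3%N i.
rewrite (G 0%N 0%N) // (G 1%N 1%N) // (G 0%N 1%N) //= /pf6.
rewrite !c1 (G3 3%N) // (G3 4%N) // (G3 5%N) // (G3 6%N) // (G3 7%N) //=.
lra.
Qed.

(** The curvature of h1, h2 + h3, which polarises frame_pf. *)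
Lemma frame_pf_sum h1 h2 h3 h4 h5 h6 h7 h8 : frame a k h1 h2 h3 h4 h5 h6 h7 h8 ->
  a * pf4 (F h1 (h2 + h3)) h5 h6 h7 h8 = 2 * (k / 6).
Proof.
move=> [on c1 c2 c3 th]; have := th h1 (h2 + h3).
rewrite -alt8_shear23; last exact: theta_alternating.
have G i j := on i j; have G3 i := on 3%N i.
rewrite th_pf /gram2 !(innD ig, innDr ig).
rewrite (G 0%N 0%N) // (G 1%N 1%N) // (G 0%N 1%N) // (G 0%N 2%N) // (G 1%N 2%N) //.
rewrite (G 2%N 1%N) // (G 2%N 2%N) //= /pf6.
have FE y : F h1 (h2 + h3) h3 y = a * g h4 y.
  by rewrite -[h2]scale1r (a4lin2 AF) (a4_11 AF) c1; ring.
rewrite !FE (G3 3%N) // (G3 4%N) // (G3 5%N) // (G3 6%N) // (G3 7%N) //=.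
lra.
Qed.

(** The curvature of h1, h5. The minus sign comes from moving h5 past h2, h3
    and h4. *)
Lemma frame_det h1 h2 h3 h4 h5 h6 h7 h8 : frame a k h1 h2 h3 h4 h5 h6 h7 h8 ->
  pf6 (F h1 h5) h2 h3 h4 h6 h7 h8 = - (k / 6).
Proof.
move=> [on c1 c2 c3 th]; have := alt8_move5 (theta_alternating Phi_form h1 h5 h1 h5) h1 h2 h3 h4 h5 h6 h7 h8.
rewrite th th_pf /gram2 (on 0%N 0%N) // (on 4%N 4%N) // (on 0%N 4%N) //=.
lra.
Qed.

Lemma frame_det_sum h1 h2 h3 h4 h5 h6 h7 h8 : frame a k h1 h2 h3 h4 h5 h6 h7 h8 ->
  pf6 (F h1 (h5 + h6)) h2 h3 h4 h6 h7 h8 = - (2 * (k / 6)).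
Proof.
move=> [on c1 c2 c3 th].
have A := theta_alternating Phi_form h1 (h5 + h6) h1 (h5 + h6).
have := alt8_move5 A h1 h2 h3 h4 h5 h6 h7 h8.
rewrite -(alt8_shear26 A) th th_pf /gram2 !(innD ig, innDr ig) (on 0%N 0%N) // (on 4%N 4%N) //.
rewrite (on 0%N 4%N) // (on 0%N 5%N) // (on 4%N 5%N) // (on 5%N 4%N) // (on 5%N 5%N) //=.
lra.
Qed.

Definition det3 (a1 a2 a3 b1 b2 b3 c1 c2 c3 : R) :=
  a1 * (b2 * c3 - b3 * c2) - a2 * (b1 * c3 - b3 * c1) + a3 * (b1 * c2 - b2 * c1).

(** The span of h2, h3, h4 is isotropic for F h1 x, so that the Pfaffian is
    the determinant of an off-diagonal block. *)
Lemma frame_det3 h1 h2 h3 h4 h5 h6 h7 h8 x y1 y2 y3 : frame a k h1 h2 h3 h4 h5 h6 h7 h8 ->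
  g h2 x = 0 -> g h3 x = 0 -> g h4 x = 0 ->
  pf6 (F h1 x) h2 h3 h4 y1 y2 y3 =
  det3 (F h1 h2 x y1) (F h1 h2 x y2) (F h1 h2 x y3)
       (F h1 h3 x y1) (F h1 h3 x y2) (F h1 h3 x y3)
       (F h1 h4 x y1) (F h1 h4 x y2) (F h1 h4 x y3).
Proof.
move=> [_ c1 c2 c3 _] x2 x3 x4.
have E23 : F h1 x h2 h3 = 0.
  by rewrite (a4C12 AF) (a4C23 AF) c1 x4; ring.
have E24 : F h1 x h2 h4 = 0.
  by rewrite (a4C12 AF) (a4C23 AF) c2 x3; ring.
have E34 : F h1 x h3 h4 = 0.
  by rewrite (a4C12 AF) (a4C23 AF) c3 x2; ring.
rewrite /pf6 /pf4 E23 E24 E34 !(a4C12 AF h1 _ x) /det3; ring.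
Qed.

(** The 2-forms F h1 h2, F h1 h3, F h1 h4 on the span of h5, ..., h8 satisfy
    the hypotheses of quaternion_scale: frame_pf and its polarisation give the
    wedge relations, and the curvatures of h1, x for x in this span give the
    entries of the product of the three forms. *)
Lemma frame_scale h1 h2 h3 h4 h5 h6 h7 h8 : frame a k h1 h2 h3 h4 h5 h6 h7 h8 ->
  a != 0 -> k != 0 -> a ^+ 6 = (k / 6) ^+ 2.
Proof.
move=> fr a0 k0; pose c := k / 6.
have c0 : c != 0 by rewrite mulf_neq0 // invr_eq0 pnatr_eq0.
have [on c1 c2 c3 _] := fr.
pose m h x y := F h1 h x y.
have mC h x y : m h y x = - m h x y by exact: a4C23.
pose p h := (m h h5 h6, m h h5 h7, m h h5 h8).
pose n h := (m h h7 h8, - m h h6 h8, m h h6 h7).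
have D h : dot3 (p h) (n h) = pf4 (F h1 h) h5 h6 h7 h8.
  by rewrite /dot3 /pf4 /= /m; ring.
have DD h h' : dot3 (p h) (n h') + dot3 (p h') (n h) =
   pf4 (F h1 (h + h')) h5 h6 h7 h8 - pf4 (F h1 h) h5 h6 h7 h8 - pf4 (F h1 h') h5 h6 h7 h8.
  have L x y : F h1 (h + h') x y = F h1 h x y + F h1 h' x y.
    by have := a4lin2 AF 1 h h' h1 x y; rewrite scale1r mul1r.
  by rewrite /dot3 /pf4 /= /m !L; ring.
have f3 := frame_rot234 fr; have f4 := frame_rot234 f3.
have P2 := frame_pf fr; have P3 := frame_pf f3; have P4 := frame_pf f4.
have Q23 := frame_pf_sum fr; have Q34 := frame_pf_sum f3; have Q42 := frame_pf_sum f4.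
have pk (x y : R) : a * x = y -> x = y / a by move=> <-; field.
have H : (c / a) ^+ 6 = c ^+ 4; last first.
  rewrite -/c; apply: (mulIf (expf_neq0 4 c0)); rewrite -{1}H; field.
  done.
(* Even permutations of h5, ..., h8 that put each vector, and each pair of
   vectors, first. *)
have fa := frame_rot678 fr; have fb := frame_rot678 fa.
have fd := frame_swap5678 fr; have fd1 := frame_rot678 fd; have fd2 := frame_rot678 fd1.
have fe := frame_swap5678 fa; have fe1 := frame_rot678 fe; have fe2 := frame_rot678 fe1.
have fq := frame_swap5678 fb.
have o i j (li : (0 < i < 4)%N) (lj : (3 < j < 8)%N) : g [:: h1; h2; h3; h4]`_i [:: h1; h2; h3; h4; h5; h6; h7; h8]`_j = 0.
  have -> : [:: h1; h2; h3; h4]`_i = [:: h1; h2; h3; h4; h5; h6; h7; h8]`_i.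
    by move: i li => [|[|[|[|//]]]].
  move: li lj => /andP[_ li] /andP[lj lj']; rewrite on ?(leq_trans li) //.
  by rewrite ltn_eqF // (leq_trans li).
have gD x y z : g z x = 0 -> g z y = 0 -> g z (x + y) = 0.
  by move=> h h'; rewrite (innDr ig) h h' addr0.
have mD h x y z : m h (x + y) z = m h x z + m h y z.
  by have := a4lin3 AF 1 x y h1 h z; rewrite scale1r mul1r.
have E55 := frame_det fr; have E66 := frame_det fd2; have E77 := frame_det fe.
have E88 := frame_det fq.
have E56 := frame_det_sum fr; have E57 := frame_det_sum fa; have E58 := frame_det_sum fb.
have E67 := frame_det_sum fd2; have E68 := frame_det_sum fd1; have E78 := frame_det_sum fe2.
have o25 := o 1%N 4%N isT isT; have o26 := o 1%N 5%N isT isT.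
have o27 := o 1%N 6%N isT isT; have o28 := o 1%N 7%N isT isT.
have o35 := o 2%N 4%N isT isT; have o36 := o 2%N 5%N isT isT.
have o37 := o 2%N 6%N isT isT; have o38 := o 2%N 7%N isT isT.
have o45 := o 3%N 4%N isT isT; have o46 := o 3%N 5%N isT isT.
have o47 := o 3%N 6%N isT isT; have o48 := o 3%N 7%N isT isT.
rewrite (frame_det3 _ _ _ fr) // in E55; rewrite (frame_det3 _ _ _ fd2) // in E66.
rewrite (frame_det3 _ _ _ fe) // in E77; rewrite (frame_det3 _ _ _ fq) // in E88.
rewrite (frame_det3 _ _ _ fr) ?gD // in E56; rewrite (frame_det3 _ _ _ fa) ?gD // in E57.
rewrite (frame_det3 _ _ _ fb) ?gD // in E58; rewrite (frame_det3 _ _ _ fd2) ?gD // in E67.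
rewrite (frame_det3 _ _ _ fd1) ?gD // in E68; rewrite (frame_det3 _ _ _ fe2) ?gD // in E78.
move: E55 E66 E77 E88 E56 E57 E58 E67 E68 E78.
rewrite -!/(m _ _ _) !mD /det3 -/c.
have mz h x : m h x x = 0 by exact: a4_22.
rewrite !mz !(mC _ h5) !(mC _ h6 h7) !(mC _ h6 h8) !(mC _ h7 h8).
move=> E55 E66 E77 E88 E56 E57 E58 E67 E68 E78.
have Xd i : skew4X (p h2) (p h3) (p h4) (n h2) (n h3) (n h4) i i = - c.
  rewrite /skew4X /p /n /= !mxE !big_ord_recl big_ord0 !mxE !big_ord_recl !big_ord0 !mxE.
  case: i => -[|[|[|[|//]]]] ? /=.
  - by move: E55; lra.
  - by move: E66; lra.
  - by move: E77; lra.
  - by move: E88; lra.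
have Xo (i j : 'I_4) : (i < j)%N -> skew4X (p h2) (p h3) (p h4) (n h2) (n h3) (n h4) i j
     + skew4X (p h2) (p h3) (p h4) (n h2) (n h3) (n h4) j i = 0.
  rewrite /skew4X /p /n /= !mxE !big_ord_recl !big_ord0 !mxE !big_ord_recl !big_ord0 !mxE.
  case: i => -[|[|[|[|//]]]] ?; case: j => -[|[|[|[|//]]]] ? //= _.
  - by move: E55 E66 E56; lra.
  - by move: E55 E77 E57; lra.
  - by move: E55 E88 E58; lra.
  - by move: E66 E77 E67; lra.
  - by move: E66 E88 E68; lra.
  - by move: E77 E88 E78; lra.
have -> : c ^+ 4 = (- c) ^+ 4 by ring.
apply: (@quaternion_scale R (p h2) (p h3) (p h4) (n h2) (n h3) (n h4) (c / a) (- c)).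
- by rewrite D; exact: pk.
- by rewrite D; exact: pk.
- by rewrite D; exact: pk.
- by rewrite mulf_neq0 // invr_eq0.
- rewrite DD (pk _ _ Q23) (pk _ _ P2) (pk _ _ P3); field; done.
- rewrite addrC DD (pk _ _ Q42) (pk _ _ P2) (pk _ _ P4); field; done.
- rewrite DD (pk _ _ Q34) (pk _ _ P3) (pk _ _ P4); field; done.
- exact: Xd.
- exact: Xo.
Qed.

End Frame.

(** * The calibration inequality *)

Section Backward.
Variables (R : realType) (W : vectType R).
Hypothesis dimW : \dim {: W} = 8%N.
Variable Phi : 4.-tuple W -> R.
Hypothesis Phi_form : alternating_form Phi.
Let F x y z w := Phi [tuple x; y; z; w].
Let AF : alt4form F := alt4form_of Phi_form.
Implicit Types (u v w x y z : W).

(** The sign s makes the curvature positive in one fixed basis; the constant k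
    takes care of any other orthonormal basis. *)
Lemma condC_curvature : condition_C Phi -> exists g : W -> W -> R, inner g /\
  forall e : 8.-tuple W, orthonormal_seq g e -> exists2 k, k != 0 &
  forall u v, theta Phi u v u v e = k * gram2 g u v.
Proof.
move=> [nd cC]; have [g0 i0] := exists_inner W.
have [e0 one0] := exists_onb dimW i0.
have bt := theta_biform Phi_form e0.
have [|s [s2 pos]] := biform_definite bt.
  by move=> u v fr; exact: (nondegenerate_theta dimW Phi_form i0 one0 nd fr).
have s0 : s != 0 by rewrite -sqrf_eq0 s2 oner_eq0.
have fr3 : free [:: e0`_0; e0`_1; e0`_2].
  apply: (orthonormal_seq_free i0) => -[|[|[|//]]] [|[|[|//]]] _ _ /=;
  by rewrite one0 ?size_tuple.
pose Q u v w x := s * theta Phi u v w x e0.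
have T0 a b c d := theta_zero dimW i0 Phi_form a b c d one0.
have Qz u v w x : Q u v w x = 0 <-> theta Phi u v w x =1 (fun=> 0).
  rewrite -T0 /Q; split=> [/eqP|->]; last by rewrite mulr0.
  by rewrite mulf_eq0 (negbTE s0) => /eqP.
have [||||g [ig gE]] := @inner_of_curvature R W Q.
- split=> [c u u' v w x|u v w x|u v w x].
  + by rewrite /Q (bi_lin bt); ring.
  + by rewrite /Q (bi_anti bt u v w x); ring.
  + by rewrite /Q (bi_sym bt u v w x).
- by move=> u v /pos.
- move=> u v w fr /Qz h1 /Qz h2 x; have := cC u v w fr h1 h2 x.
  by move=> h; rewrite !Qz.
- by exists e0`_0, e0`_1, e0`_2.
exists g; split=> // e one.
have [c [cE _]] := theta_basis dimW i0 Phi_form e one0.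
have K u v : theta Phi u v u v e = c * s * gram2 g u v.
  by rewrite cE /gram2 -gE /Q mulrA -(mulrA c) -expr2 s2 mulr1.
exists (c * s) => //.
have := nondegenerate_theta dimW Phi_form ig one nd (free3_12 fr3).
by rewrite K; apply: contra => /eqP->; rewrite mul0r.
Qed.

Section Metric.
Variable (g : W -> W -> R).
Hypothesis ig : inner g.

(** Let p represent l. Testing p / |p| gives |p| <= l h, hence |p - l h h|^2 =
    |p|^2 - (l h)^2 <= 0. *)
Lemma max_linear (l : W -> R) h : (forall c x y, l (c *: x + y) = c * l x + l y) ->
  g h h = 1 -> (forall u, g u u = 1 -> l u <= l h) -> forall y, l y = l h * g h y.
Proof.
move=> ll h1 lmax y; have [p pE] := riesz ig dimW ll.
have gp : g p p <= l h ^+ 2.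
  have [->|np] := eqVneq p 0; first by rewrite (inn0 ig) sqr_ge0.
  have p0 := inn_pos ig np; pose r := Num.sqrt (g p p).
  have r0 : 0 < r by rewrite sqrtr_gt0.
  have rE : g p p = r ^+ 2 by rewrite sqr_sqrtr // ltW.
  have := lmax (r^-1 *: p); rewrite (innZ ig) (innZr ig) rE => H.
  have {H} : l (r^-1 *: p) <= l h by apply: H; field; rewrite gt_eqF.
  rewrite -pE (innZr ig) rE expr2 mulKf ?gt_eqF // => rl.
  by rewrite -expr2 ler_pXn2r // nnegrE ?(ltW r0) // (le_trans (ltW r0)).
have : - l h *: h + p = 0.
  apply: (inn_eq0 ig); apply/eqP; rewrite eq_le inn_ge0 // andbT.
  rewrite (inn_lin ig) !(innDr ig) !(innZr ig) h1 (inn_sym ig p h) !(pE h); nra.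
rewrite scaleNr addrC => /eqP; rewrite subr_eq0 => /eqP pEh.
by rewrite -pE pEh (innZ ig).
Qed.

Section Calibration.
Variable k : R.
Hypothesis k0 : k != 0.
Variable e : 8.-tuple W.
Hypothesis one : orthonormal_seq g e.
Hypothesis K : forall u v, theta Phi u v u v e = k * gram2 g u v.

(** At a maximising quadruple, max_linear applied to each slot gives the
    first-order conditions. They make the quadruple orthonormal, and frame_scale
    applies to any completion of it to an orthonormal basis. *)
Lemma curvature_comass : exists2 a, 0 < a &
  a ^+ 6 = (k / 6) ^+ 2 /\ forall u v w x, g u u = 1 -> g v v = 1 -> g w w = 1 -> g x x = 1 ->
  F u v w x <= a.
Proof.
have [h1 [h2 [h3 [h4 [[n1 n2 n3 n4] hmax]]]]] := max_unit dimW ig AF.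
rewrite -/F in hmax; pose a := F h1 h2 h3 h4.
have c4 y : F h1 h2 h3 y = a * g h4 y.
  apply: (max_linear (l := F h1 h2 h3)) => // *; [exact: a4lin4|exact: hmax].
have c3 y : F h1 h2 h4 y = - a * g h3 y.
  rewrite (a4C23 AF) mulNr; congr (- _).
  apply: (max_linear (l := fun y => F h1 h2 y h4)) => // *; [exact: a4lin3|exact: hmax].
have c2 y : F h1 h3 h4 y = a * g h2 y.
  rewrite (a4C23 AF) (a4C12 AF) opprK.
  apply: (max_linear (l := fun y => F h1 y h3 h4)) => // *; [exact: a4lin2|exact: hmax].
have c1 y : F h2 h3 h4 y = - a * g h1 y.
  rewrite (a4C23 AF) (a4C12 AF) (a4C01 AF) opprK mulNr; congr (- _).
  apply: (max_linear (l := fun y => F y h2 h3 h4)) => // *; [exact: a4lin|exact: hmax].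
have hle u v w x : g u u = 1 -> g v v = 1 -> g w w = 1 -> g x x = 1 -> F u v w x <= a.
  exact: hmax.
have a_ge0 : 0 <= a.
  have := hle h2 h1 h3 h4 n2 n1 n3 n4; rewrite (a4C01 AF) -/a; lra.
have Nz : a != 0.
  apply: contra k0 => /eqP a0.
  have F0 u v w x : g u u = 1 -> g v v = 1 -> g w w = 1 -> g x x = 1 -> F u v w x = 0.
    move=> *; apply/eqP; rewrite eq_le -{1}a0 hle //=.
    by rewrite -oppr_le0 -(a4C01 AF) -a0 hle.
  have on3 : orthonormal_seq g [:: e`_0; e`_1; e`_2].
    by apply: (orthonormal_seq_map (idx := [:: 0; 1; 2]%N) one) => //; rewrite /= size_tuple.
  have [f3 [f4 [f5 [f6 [f7 [b [s [[on8 _ _ _] _]]]]]]]] :=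
    theta_adapted dimW Phi_form ig one on3.
  rewrite K -/(F e`_0 e`_1 f4 f5) F0; first last.
  - by rewrite (on8 5%N 5%N).
  - by rewrite (on8 4%N 4%N).
  - by rewrite (on8 1%N 1%N).
  - by rewrite (on8 0%N 0%N).
  rewrite /gram2 (on8 0%N 0%N) // (on8 1%N 1%N) // (on8 0%N 1%N) //= => h.
  by apply/eqP; move: h; lra.
have an (x : R) : a * x = 0 -> x = 0.
  by move/eqP; rewrite mulf_eq0 (negbTE Nz) => /eqP.
have g41 : g h4 h1 = 0 by apply: an; rewrite -c4 (a4_03 AF).
have g42 : g h4 h2 = 0 by apply: an; rewrite -c4 (a4_13 AF).
have g43 : g h4 h3 = 0 by apply: an; rewrite -c4 (a4_22 AF).
have g31 : g h3 h1 = 0 by apply: an; apply: oppr_inj; rewrite -mulNr -c3 (a4_03 AF) oppr0.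
have g32 : g h3 h2 = 0 by apply: an; apply: oppr_inj; rewrite -mulNr -c3 (a4_13 AF) oppr0.
have g21 : g h2 h1 = 0 by apply: an; rewrite -c2 (a4_03 AF).
have s := inn_sym ig.
have on4 : orthonormal_seq g [:: h1; h2; h3; h4].
  move=> [|[|[|[|//]]]] [|[|[|[|//]]]] _ _ //=;
    rewrite ?n1 ?n2 ?n3 ?n4 ?g21 ?g31 ?g32 ?g41 ?g42 ?g43 //;
    by rewrite s ?g21 ?g31 ?g32 ?g41 ?g42 ?g43.
have [|r [sr on8]] := orthonormal_seq_extend ig dimW (n := 4) on4; first by [].
case: r sr on8 => [//|h5 [//|h6 [//|h7 [//|h8 [|//]]]]] _ on8.
have [c [cE c21]] := theta_basis dimW ig Phi_form [tuple h1; h2; h3; h4; h5; h6; h7; h8] one.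
have {}c21 := c21 on8.
have fr : frame g Phi a (c * k) h1 h2 h3 h4 h5 h6 h7 h8.
  by split=> // u v; rewrite cE K mulrA.
exists a; first by rewrite lt0r Nz.
split=> //; rewrite (frame_scale ig Phi_form fr) //.
  by rewrite -mulrA exprMn c21 mul1r.
by rewrite mulf_neq0 // -sqrf_eq0 c21 oner_eq0.
Qed.

(** In an adapted basis the curvature k of f0, f1 is, up to sign, 6 times a
    product of three values of F on orthonormal vectors. Each is at most a in
    absolute value and their product is a^3 in absolute value, so none can be
    smaller than a. *)
Lemma comass_attained a f0 f1 f2 : 0 < a -> a ^+ 6 = (k / 6) ^+ 2 ->
  (forall u v w x, g u u = 1 -> g v v = 1 -> g w w = 1 -> g x x = 1 -> F u v w x <= a) ->
  orthonormal_seq g [:: f0; f1; f2] ->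
  exists f3 b, [/\ g f3 f3 = 1, b ^+ 2 = a ^+ 2 & forall z, F f0 f1 f2 z = b * g f3 z].
Proof.
move=> a0 a6 amax on3.
have [f3 [f4 [f5 [f6 [f7 [b [s [[on8 F3 _ _] s2]]]]]]]] :=
  theta_adapted dimW Phi_form ig one on3.
rewrite -/(F f0 f1 f4 f5) -/(F f0 f1 f6 f7) K.
have G i := on8 i i.
have g0 : g f0 f0 = 1 by rewrite (G 0%N). have g1 : g f1 f1 = 1 by rewrite (G 1%N).
have g2 : g f2 f2 = 1 by rewrite (G 2%N). have g3 : g f3 f3 = 1 by rewrite (G 3%N).
have g4 : g f4 f4 = 1 by rewrite (G 4%N). have g5 : g f5 f5 = 1 by rewrite (G 5%N).
have g6 : g f6 f6 = 1 by rewrite (G 6%N). have g7 : g f7 f7 = 1 by rewrite (G 7%N).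
rewrite /gram2 g0 g1 (on8 0%N 1%N) //= => kE.
have sq x y : g x x = 1 -> g y y = 1 -> F f0 f1 x y ^+ 2 <= a ^+ 2.
  move=> x1 y1; have := amax f0 f1 x y g0 g1 x1 y1; have := amax f1 f0 x y g1 g0 x1 y1.
  rewrite (a4C01 AF); nra.
have bE : b = F f0 f1 f2 f3 by rewrite /F F3 g3 mulr1.
exists f3, b; split=> //.
apply/eqP; rewrite eq_le {1}bE sq //=.
have A := sq _ _ g4 g5; have B := sq _ _ g6 g7.
move: A B kE a6; move: (F f0 f1 f4 f5) (F f0 f1 f6 f7) => p q A B kE a6.
have a6' : a ^+ 6 = b ^+ 2 * (p ^+ 2 * q ^+ 2).
  have -> : b ^+ 2 * (p ^+ 2 * q ^+ 2) = s ^+ 2 * (b ^+ 2 * (p ^+ 2 * q ^+ 2)) by rewrite s2 mul1r.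
  rewrite a6; have -> : k = s * (6 * (b * p * q)) by rewrite -kE; ring.
  by field.
have pq : p ^+ 2 * q ^+ 2 <= a ^+ 4.
  have -> : a ^+ 4 = a ^+ 2 * a ^+ 2 by ring.
  by apply: ler_pM => //; exact: sqr_ge0.
have a4 : 0 < a ^+ 4 by rewrite exprn_gt0.
rewrite -(ler_pM2r a4) -exprD a6'; apply: ler_wpM2l => //; exact: sqr_ge0.
Qed.

End Calibration.
End Metric.
End Backward.

(** * The compatible inner product *)

Section Rescale.
Variables (R : realType) (W : vectType R).
Hypothesis dimW : \dim {: W} = 8%N.
Variable Phi : 4.-tuple W -> R.
Hypothesis Phi_form : alternating_form Phi.
Let F x y z w := Phi [tuple x; y; z; w].
Let AF : alt4form F := alt4form_of Phi_form.
Implicit Types (u v w x y z : W).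

Lemma inner_scale (g : W -> W -> R) r : inner g -> 0 < r -> inner (fun x y => r * g x y).
Proof.
move=> ig r0; split=> [c x y z|x y|x /(inn_pos ig)].
- by rewrite (inn_lin ig); ring.
- by rewrite (inn_sym ig).
- exact: mulr_gt0.
Qed.

Lemma gram_det (g : W -> W -> R) f0 f1 f2 a b c d k l r : inner g ->
  orthonormal_seq g [:: f0; f1; f2] ->
  let t := [tuple a *: f0; b *: f0 + c *: f1; d *: f0 + (k *: f1 + l *: f2)] in
  \det (\matrix_(i < 3, j < 3) (r * g (tnth t i) (tnth t j))) = r ^+ 3 * (a * c * l) ^+ 2.
Proof.
move=> ig on t.
pose L : 'M[R]_3 := \matrix_(i < 3, j < 3)
  nth 0 (nth [::] [:: [:: a; 0; 0]; [:: b; c; 0]; [:: d; k; l]] i) j.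
have dL : \det L = a * c * l.
  rewrite det_trig; first by rewrite !big_ord_recl big_ord0 !mxE /=; ring.
  by apply/is_trig_mxP => -[[|[|[|//]]] ?] [[|[|[|//]]] ?] //= _; rewrite mxE.
rewrite (_ : \matrix_(_, _) _ = r *: (L *m L^T)).
  by rewrite detZ det_mulmx det_tr dL expr2.
apply/matrixP => i j; rewrite !mxE !big_ord_recl big_ord0 !mxE !(tnth_nth 0).
have G0 := on 0%N. have G1 := on 1%N. have G2 := on 2%N.
case: i => -[|[|[|//]]] ?; case: j => -[|[|[|//]]] ? /=;
rewrite !(innD ig, innDr ig, innZ ig, innZr ig);
rewrite ?(G0 0%N) ?(G0 1%N) ?(G0 2%N) ?(G1 0%N) ?(G1 1%N) ?(G1 2%N)
  ?(G2 0%N) ?(G2 1%N) ?(G2 2%N) //=; ring.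
Qed.

(** With r = sqrt a, the product of a g-orthonormal triple has squared length
    a^2 / r = r^3 for d, and this is also the Gram determinant of the triple for
    d. General triples reduce to this case by Gram-Schmidt. *)
Lemma calibrated_compatible (g : W -> W -> R) a (d : {dot W for idfun}) : inner g -> 0 < a ->
  (forall f0 f1 f2, orthonormal_seq g [:: f0; f1; f2] ->
    exists f3 b, [/\ g f3 f3 = 1, b ^+ 2 = a ^+ 2 & forall z, F f0 f1 f2 z = b * g f3 z]) ->
  (forall x y, d x y = Num.sqrt a * g x y) -> compatible d Phi.
Proof.
move=> ig a0 cal dE; pose r := Num.sqrt a; have r0 : 0 < r by rewrite sqrtr_gt0.
have rn : r != 0 by rewrite gt_eqF.
have ra : r ^+ 2 = a by rewrite sqr_sqrtr // ltW.
have id := dot_inner d.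
have [e one] := exists_onb dimW ig.
pose m (t : 3.-tuple W) := \sum_(i < 8) (r^-1 * Phi [tuple of e`_i :: t]) *: e`_i.
have [mPhi aPhi] := Phi_form.
have mE x t : d x (m t) = Phi [tuple of x :: t].
  rewrite dE /m (inn_sumr ig) big_distrr /=.
  have lin := multilinear_head t mPhi.
  rewrite [in RHS](onb_expand ig dimW x one (size_tuple e)).
  have l0 : Phi [tuple of 0 :: t] = 0.
    have h : Phi [tuple of 0 :: t] = Phi [tuple of 0 :: t] + Phi [tuple of 0 :: t] :> R.
      by have := lin 1 0 0; rewrite scaler0 addr0 scale1r.
    by lra.
  have lD y z : Phi [tuple of (y + z) :: t] = Phi [tuple of y :: t] + Phi [tuple of z :: t].
    by have := lin 1 y z; rewrite !scale1r.
  rewrite (big_morph (fun y => Phi [tuple of y :: t]) lD l0).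
  apply: eq_bigr => i _; have := lin (g x e`_i) e`_i 0.
  rewrite addr0 /= l0 addr0 => ->; rewrite (innZr ig) -/r [in RHS]/GRing.scale /=; field.
  by [].
exists m; split=> [x u v w|].
  by rewrite mE; congr Phi; apply: val_inj.
split.
  split=> [t i c x y|t i j nij tij].
    rewrite /m scaler_sumr -big_split; apply: eq_bigr => k _ /=.
    rewrite (multilinear_cons e`_k mPhi) /= scalerA -scalerDl; congr (_ *: _).
    by rewrite [in LHS]/GRing.scale /=; ring.
  rewrite /m big1 // => k _.
  have nij' : lift ord0 i != lift ord0 j by rewrite (inj_eq lift_inj).
  by rewrite (aPhi [tuple of e`_k :: t] _ _ nij') ?mulr0 ?scale0r // !tnthS.
move=> u v w.
have mF x : d (m [tuple u; v; w]) x = F x u v w.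
  by rewrite (inn_sym id) mE; congr Phi; apply: val_inj.
split; rewrite ?mF ?(a4_00 AF) ?(a4_02 AF) ?(a4_03 AF) //.
rewrite /norm /norm_wedge; congr Num.sqrt.
have [f0 [f1 [f2 [A [B [C [D [K [L [on3 uE vE wE]]]]]]]]]] := gram_schmidt3 dimW ig u v w.
have [f3 [b [g3 b2 F3]]] := cal _ _ _ on3.
have mz : m [tuple u; v; w] = (- (A * C * L * b / r)) *: f3.
  apply: (inn_inj id) => z; rewrite mF (innZ id) dE -/r.
  have -> : F z u v w = - F u v w z.
    by rewrite (a4C01 AF u z) (a4C12 AF u v z) (a4C23 AF u v w z) !opprK.
  by rewrite uE vE wE /F (a4_triangular Phi_form) -/(F f0 f1 f2 z) F3; field.
rewrite mz (innZ id) (innZr id) dE -/r g3.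
rewrite (_ : \matrix_(_, _) _ = \matrix_(i < 3, j < 3) (r * g (tnth [tuple u; v; w] i) (tnth [tuple u; v; w] j))); last first.
  by apply/matrixP => i j; rewrite !mxE dE.
rewrite uE vE wE (gram_det _ _ _ _ _ _ _ ig on3).
have -> : - (A * C * L * b / r) * (- (A * C * L * b / r) * (r * 1)) = (A * C * L) ^+ 2 * b ^+ 2 / r.
  by field.
by rewrite b2 -ra; field.
Qed.

Lemma condC_compatible : condition_C Phi -> exists d : {dot W for idfun}, compatible d Phi.
Proof.
move=> cC; have [g [ig gK]] := condC_curvature dimW Phi_form cC.
have [e one] := exists_onb dimW ig; have [k k0 K] := gK e one.
have [a a0 [a6 amax]] := curvature_comass dimW Phi_form ig k0 one K.
have r0 : 0 < Num.sqrt a by rewrite sqrtr_gt0.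
have [d dE] := inner_dot (inner_scale ig r0).
exists d; apply: (calibrated_compatible ig a0) => // f0 f1 f2 on3.
exact: (comass_attained dimW Phi_form ig one K a0 a6 amax on3).
Qed.

Lemma compatible_condC (d : {dot W for idfun}) : compatible d Phi -> condition_C Phi.
Proof.
move=> cd; have id := dot_inner d; have cg := compatible_cross Phi_form cd.
have [e one] := exists_onb dimW id.
have [k k2 K] := cross_curvature dimW Phi_form id cg one.
apply: (curvature_condC dimW Phi_form id one _ K).
  by rewrite -sqrf_eq0 k2 pnatr_eq0.
exact: (cross_nondegenerate dimW Phi_form id cg).
Qed.

End Rescale.

Theorem theorem7p8 (R : realType) (W : vectType R) (dimW : \dim {: W} = 8%N)
    (Phi : 4.-tuple W -> R) (Phi_form : alternating_form Phi) :
  ((exists g : {dot W for idfun}, compatible g Phi) <-> condition_C Phi) /\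
  (condition_C Phi ->
   forall g1 g2 : {dot W for idfun},
     compatible g1 Phi -> compatible g2 Phi -> g1 =2 g2).
Proof.
split; first split.
- by move=> [d]; exact: compatible_condC.
- exact: condC_compatible.
move=> _ g1 g2 c1 c2.
exact: (cross_unique dimW Phi_form (dot_inner g1) (dot_inner g2)
  (compatible_cross Phi_form c1) (compatible_cross Phi_form c2)).
Qed.
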